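(* Let $n \geq 1$ and $k \in \{1, 2\}$. The partially ordered set $B_B(J_n,k)$ has a unique maximal element, namely $[\rho_{max}]$, and a unique minimal element, namely $[\rho_{min}]$.
   Context: **Sets.** For $n\ge 1$ let $J_n=\{-n,\dots,-1,1,\dots,n\}$. For a finite set $E\subset\mathbb Z\setminus\{0\}$ with $E=-E$, let $E_+$ be its set of positive elements. Put $C_B(E,1)=E$. For $k>1$: $C_B^1(E,k)$ is the set of $k$-element subsets of $E$ whose elements have pairwise distinct absolute values, modulo the identification $S\sim -S$; the class of $\{a_1,\dots,a_k\}$ is written $[a_1,\dots,a_k]$. $C_B^2(E,k)=\{T\cup\{\star\}: T\subset E_+,\ |T|=k-1\}$, where $\star$ is a formal symbol; such an element is written $[b_1,\dots,b_{k-1},\star]$ or equivalently $[-b_1,\dots,-b_{k-1},\star]$. Put $C_B(E,k)=C_B^1(E,k)\cup C_B^2(E,k)$. **Packets.** To $K\in C_B(J_n,k+1)$ is attached its packet $P_B(K)\subset C_B(J_n,k)$ (a ''$k$-packet''): if $K=[a,b]\in C_B^1(J_n,2)$ then $P_B(K)=\{a,-a,b,-b\}$; if $K=[a_1,\dots,a_{k+1}]\in C_B^1(J_n,k+1)$ with $k>1$ then $P_B(K)$ is the set of classes of the $k$-element subsets of $\{a_1,\dots,a_{k+1}\}$; if $K\in C_B^2(J_n,k+1)$ and $K'=K\setminus\{\star\}$ then $P_B(K)=C_B(K'\cup(-K'),k)$. **Preferred representatives.** For an element of $C_B^1(J_n,k)$, the preferred representative is the one whose element of greatest absolute value is negative.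 **Standard orders.** The standard order $\rho_{min}$ on $C_B(J_n,1)=J_n$ is the usual order of integers. The standard order $\rho_{min}$ on $C_B(J_n,2)$ uses preferred representatives, listed increasingly as $[a_1,a_2]$ with $a_1<a_2$, and represents $[a,\star]$ ($a>0$) by $[-a,a]$: elements with two negative indices come first (are smallest), in lexicographic order; then come the elements with exactly one negative index, ordered by $[a_1,a_2]<[b_1,b_2]$ if $a_1<b_1$, or $a_1=b_1$ and $a_2>b_2$. $\rho_{max}$ is the reverse of $\rho_{min}$. **Packet orders.** For a $2$-packet $P_B(K)$, the standard packet order is the restriction of $\rho_{min}$ on $C_B(J_n,2)$. For $k=1$ the packet order is a partial order depending on $K$: if $K=[j,i]\in C_B^1(J_n,2)$ with $\{j,i\}$ preferred ($j<0$, $|j|>|i|$), the relations are $j<i$ and $-i<-j$ only; if $K=[k,\star]$ with $k>0$, the relation is $-k<k$. $\mathrm{Rev}\,P_B(K)$ denotes the packet with the opposite order. A comparable component of a poset is a connected component of its Hasse diagram. **Admissible orders and $B_B$.** A total order $\rho$ of $C_B(J_n,k)$ is admissible if for every $K\in C_B(J_n,k+1)$ it extends the standard order of $P_B(K)$ or that of $\mathrm{Rev}\,P_B(K)$. $A_B(J_n,k)$ is the set of admissible orders; it contains $\rho_{min},\rho_{max}$. $\mathrm{Inv}(\rho)$ is the set of $K\in C_B(J_n,k+1)$ such that $\rho$ extends $\mathrm{Rev}\,P_B(K)$. $N(\rho)$ is the set of $K\in C_B(J_n,k+1)$ such that each comparable component of $P_B(K)$ forms a chain in $\rho$, meaning a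 set of consecutive elements of $\rho$. Two elements of $C_B(J_n,k)$ commute if they are incomparable in the packet order of every $k$-packet $P_B(K)$ containing both. Two admissible orders are elementarily equivalent if one is obtained from the other by exchanging two adjacent commuting elements; $\sim$ is the equivalence relation generated by this, $B_B(J_n,k)=A_B(J_n,k)/\sim$, and $[\rho]$ is the class of $\rho$. $\mathrm{Inv}$ is constant on classes, so $\mathrm{Inv}([\rho])$ is defined; $N([\rho])=\bigcup_{\rho'\in[\rho]}N(\rho')$. **Packet flips and the partial order.** For $K\in N(\rho)$, $p_K(\rho)$ is the admissible order obtained from $\rho$ by reversing the order of each comparable component of $P_B(K)$ in place. For $r\in B_B(J_n,k)$ and $K\in N(r)$, $p_K(r)=[p_K(\rho)]$ for any $\rho\in r$ with $K\in N(\rho)$. The partial order on $B_B(J_n,k)$: $r\le r'$ iff there are $r=r_0,r_1,\dots,r_m=r'$ ($m\ge0$) and $K_1,\dots,K_m\in C_B(J_n,k+1)$ with $K_t\in N(r_{t-1})\setminus\mathrm{Inv}(r_{t-1})$ and $r_t=p_{K_t}(r_{t-1})$ for all $t$. *)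

(* Defs.v *)
From Stdlib Require Export Relation_Operators.
From mathcomp Require Export all_boot all_order all_algebra.
From mathcomp Require Export finmap boolp classical_sets.

Set Implicit Arguments.
Unset Strict Implicit.
Unset Printing Implicit Defensive.

Import Order.TTheory GRing.Theory Num.Theory.

Local Open Scope classical_set_scope.
Local Open Scope ring_scope.

(** Finite sets of integers are [{fset int}]; sets of elements, orders and
    classes of orders are classical sets.  All orders are strict. *)

Definition negs (S : {fset int}) : {fset int} := [fset - x | x in S]%fset.

Definition posp (E : {fset int}) : {fset int} := [fset x in E | 0 < x]%fset.

Definition J (n : nat) : {fset int} :=
  ([fset Posz i | i in iota 1 n] `|` [fset - Posz i | i in iota 1 n])%fset.

(** The elements of the sets C_B(E,k):
    - [Single a] is the integer a, used when k = 1;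
    - [Cls c] is a class of subsets modulo S ~ -S, the class being given as the
      set c = {S, -S} of its representatives;
    - [Star T] is T together with the formal symbol *, with T a set of positive
      integers. *)
Inductive elt : Type :=
| Single of int
| Cls of {fset {fset int}}
| Star of {fset int}.

(** The class [a_1,...,a_k] of the set S = {a_1,...,a_k}. *)
Definition brk (S : {fset int}) : elt := Cls [fset S; negs S]%fset.

Definition CB1 (E : {fset int}) (k : nat) : set elt :=
  [set x | exists S : {fset int},
     [/\ (S `<=` E)%fset, #|` S| = k, {in S &, injective absz} & x = brk S]].

Definition CB2 (E : {fset int}) (k : nat) : set elt :=
  [set x | exists T : {fset int},
     [/\ (T `<=` posp E)%fset, #|` T|.+1 = k & x = Star T]].

Definition CB (E : {fset int}) (k : nat) : set elt :=
  if k == 1%N then [set Single a | a in [set` E]] else CB1 E k `|` CB2 E k.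

(** [packet k K] is the k-packet of K, an element of C_B(J_n,k+1).  For k = 1
    both representatives of K = [a,b] contribute, giving {a,-a,b,-b}; for k > 1
    they contribute the same classes.  Since k+1 > 1, the case [Single] does not
    occur. *)
Definition packet (k : nat) (K : elt) : set elt :=
  match K with
  | Single _ => set0
  | Cls c =>
      if k == 1%N
      then [set x | exists (S : {fset int}) (a : int),
              [/\ S \in c, a \in S & x = Single a]]
      else [set x | exists S S' : {fset int},
              [/\ S \in c, (S' `<=` S)%fset, #|` S'| = k & x = brk S']]
  | Star T => CB (T `|` negs T)%fset k
  end.

Definition preferred (S : {fset int}) : Prop :=
  exists2 m : int, m \in S & m < 0 /\ forall a : int, a \in S -> `|a| <= `|m|.

(** [pair_rep x p]: p lists increasingly the preferred representative of the
    element x of C_B(J_n,2), where [a,*] is represented by [-a,a]. *)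
Definition pair_rep (x : elt) (p : int * int) : Prop :=
  (x = brk [fset p.1; p.2]%fset /\ preferred [fset p.1; p.2]%fset /\ p.1 < p.2)
  \/ (exists a : int, [/\ 0 < a, x = Star [fset a]%fset & p = (- a, a)]).

Definition both_neg (p : int * int) : bool := (p.1 < 0) && (p.2 < 0).

(** The smaller entry of a pair as in [pair_rep] is always negative, so a pair
    that is not [both_neg] has exactly one negative entry. *)
Definition pair_lt (p q : int * int) : bool :=
  match both_neg p, both_neg q with
  | true, true => (p.1 < q.1) || ((p.1 == q.1) && (p.2 < q.2))
  | true, false => true
  | false, true => false
  | false, false => (p.1 < q.1) || ((p.1 == q.1) && (q.2 < p.2))
  end.

Definition eorder := elt -> elt -> Prop.

Definition opp_order (R : eorder) : eorder := fun x y => R y x.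

Definition std_lt1 : eorder := fun x y =>
  exists a b : int, [/\ x = Single a, y = Single b & a < b].

Definition std_lt2 : eorder := fun x y =>
  exists p q : int * int, [/\ pair_rep x p, pair_rep y q & pair_lt p q].

(** Standard orders and packet orders are only meaningful for k = 1 and k = 2;
    for other k the empty relation is a junk value. *)
Definition std_lt (k : nat) : eorder :=
  match k with
  | 1 => std_lt1
  | 2 => std_lt2
  | _ => fun _ _ => False
  end.

Definition rho_min (n k : nat) : eorder := fun x y =>
  [/\ CB (J n) k x, CB (J n) k y & std_lt k x y].

Definition rho_max (n k : nat) : eorder := opp_order (rho_min n k).

Definition packet_lt1 (K : elt) : eorder := fun x y =>
  (exists j i : int,
     [/\ K = brk [fset j; i]%fset, j < 0, `|i| < `|j| &
         (x = Single j /\ y = Single i)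
         \/ (x = Single (- i) /\ y = Single (- j))])
  \/ (exists a : int,
     [/\ 0 < a, K = Star [fset a]%fset, x = Single (- a) & y = Single a]).

Definition packet_lt2 (K : elt) : eorder := fun x y =>
  [/\ packet 2 K x, packet 2 K y & std_lt2 x y].

Definition packet_lt (k : nat) (K : elt) : eorder :=
  match k with
  | 1 => packet_lt1 K
  | 2 => packet_lt2 K
  | _ => fun _ _ => False
  end.

Definition covers (k : nat) (K : elt) : eorder := fun x y =>
  packet_lt k K x y /\ ~ exists z, packet_lt k K x z /\ packet_lt k K z y.

(** The comparable components of the packet of K: the connected components of
    its Hasse diagram. *)
Definition components (k : nat) (K : elt) : set (set elt) :=
  [set C | exists2 x, packet k K x &
     C = [set y | packet k K y /\ clos_refl_sym_trans elt (covers k K) x y]].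

Definition total_order_on (A : set elt) (rho : eorder) : Prop :=
  [/\ forall x y, rho x y -> A x /\ A y,
      forall x, ~ rho x x,
      forall x y z, rho x y -> rho y z -> rho x z &
      forall x y, A x -> A y -> x <> y -> rho x y \/ rho y x].

Definition extends (rho R : eorder) : Prop := forall x y, R x y -> rho x y.

(** A_B(J_n,k) *)
Definition AB (n k : nat) : set eorder :=
  [set rho | total_order_on (CB (J n) k) rho /\
     forall K, CB (J n) k.+1 K ->
       extends rho (packet_lt k K) \/ extends rho (opp_order (packet_lt k K))].

Definition Inv (n k : nat) (rho : eorder) : set elt :=
  [set K | CB (J n) k.+1 K /\ extends rho (opp_order (packet_lt k K))].

Definition consecutive (rho : eorder) (C : set elt) : Prop :=
  forall x y z, C x -> C z -> rho x y -> rho y z -> C y.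

Definition N (n k : nat) (rho : eorder) : set elt :=
  [set K | CB (J n) k.+1 K /\
     forall C, components k K C -> consecutive rho C].

Definition commute (n k : nat) (x y : elt) : Prop :=
  forall K, CB (J n) k.+1 K -> packet k K x -> packet k K y ->
    ~ packet_lt k K x y /\ ~ packet_lt k K y x.

Definition adjacent (rho : eorder) (x y : elt) : Prop :=
  rho x y /\ ~ exists z, rho x z /\ rho z y.

(** [exchange rho x y] is [rho] with its adjacent elements x, y (x before y)
    exchanged. *)
Definition exchange (rho : eorder) (x y : elt) : eorder := fun u v =>
  (rho u v /\ ~ (u = x /\ v = y)) \/ (u = y /\ v = x).

Definition elem_equiv (n k : nat) (rho rho' : eorder) : Prop :=
  [/\ AB n k rho, AB n k rho' &
      exists x y, [/\ adjacent rho x y, commute n k x y &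
                      rho' = exchange rho x y]].

(** [cls n k rho] is the class [rho]; the quotient B_B(J_n,k) is the set of
    these classes. *)
Definition cls (n k : nat) (rho : eorder) : set eorder :=
  [set rho' | clos_refl_sym_trans eorder (elem_equiv n k) rho rho'].

Definition BB (n k : nat) : set (set eorder) :=
  [set r | exists2 rho, AB n k rho & r = cls n k rho].

(** [Inv] is constant on classes, so this union is the common value. *)
Definition InvB (n k : nat) (r : set eorder) : set elt :=
  \bigcup_(rho in r) Inv n k rho.

Definition NB (n k : nat) (r : set eorder) : set elt :=
  \bigcup_(rho in r) N n k rho.

(** The packet flip p_K on orders: each comparable component of the packet of K
    is reversed in place. *)
Definition flip (k : nat) (K : elt) (rho : eorder) : eorder := fun x y =>
  let same := exists C, [/\ components k K C, C x & C y] in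
  (same /\ rho y x) \/ (~ same /\ rho x y).

(** [flipB n k K r r'] says r' = p_K(r). *)
Definition flipB (n k : nat) (K : elt) (r r' : set eorder) : Prop :=
  exists rho, [/\ r rho, N n k rho K & r' = cls n k (flip k K rho)].

Definition stepB (n k : nat) (r r' : set eorder) : Prop :=
  [/\ BB n k r, BB n k r' &
      exists K, [/\ NB n k r K, ~ InvB n k r K & flipB n k K r r']].

Definition leB (n k : nat) : set eorder -> set eorder -> Prop :=
  clos_refl_trans (set eorder) (stepB n k).

Definition maximal (n k : nat) (r : set eorder) : Prop :=
  BB n k r /\ forall r', BB n k r' -> leB n k r r' -> r' = r.

Definition minimal (n k : nat) (r : set eorder) : Prop :=
  BB n k r /\ forall r', BB n k r' -> leB n k r' r -> r' = r.

(* Main.v *)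
(* Two admissible orders that agree on all non-commuting pairs are equivalent,
   and flipping a packet strictly enlarges Inv; so it suffices to find, in the
   class of any order in which some packet is not inverted, an order where a
   non-inverted packet forms chains.  Minimality follows by reversing orders.

   For k = 1, take an adjacent pair that is still in increasing order.

   For k = 2, an admissible order is a symmetric arrangement of wires indexed by
   J_n, [a,b] being the crossing of the wires a and b (and of -a and -b), and
   [a,*] that of a and -a.  For wires u < v < w, the crossings are met in the
   order uv, uw, vw or its reverse, and the standard one is uv, uw, vw exactly
   when v < 0.  Among all non-inverted triangles with v < 0 choose one whose
   first crossing uv is latest, and among these one whose last crossing vw is
   earliest.  If another wire crossed a side of this triangle, the possible
   arrangements of four wires would yield a non-inverted triangle starting later,
   or starting at uv and ending earlier.  Hence the sides are empty, and the
   crossings of the packet can be gathered by commutations. *)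
From HB Require Import structures.
From Stdlib Require Import Operators_Properties.
Require Import Defs.
From mathcomp Require Import zify.

Set Implicit Arguments.
Unset Strict Implicit.
Unset Printing Implicit Defensive.

Import Order.TTheory GRing.Theory Num.Theory.

Local Open Scope classical_set_scope.
Local Open Scope ring_scope.

HB.instance Definition _ := gen_eqMixin elt.

(** * Total orders given by keys *)

(** Numerical keys turn comparisons in a finite total order into arithmetic; only their relative
    sizes matter, so gaps between keys are allowed. *)
Definition key_order (A : set elt) (f : elt -> nat) : eorder :=
  fun x y => [/\ A x, A y & (f x < f y)%N].

Definition inj_on (A : set elt) (f : elt -> nat) : Prop :=
  forall x y, A x -> A y -> f x = f y -> x = y.

Definition enumerable (A : set elt) : Prop :=
  exists L : seq elt, forall x, A x -> x \in L.

Lemma key_order_total (A : set elt) f :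
  inj_on A f -> total_order_on A (key_order A f).
Proof.
move=> fI; split.
- by move=> x y [].
- by move=> x [_ _]; rewrite ltnn.
- by move=> x y z [Ax Ay xy] [_ Az yz]; split=> //; apply: ltn_trans yz.
- move=> x y Ax Ay nxy; case: (ltngtP (f x) (f y)) => h.
  + by left.
  + by right.
  + by case: nxy; apply: fI.
Qed.

Lemma count_lt_sub (T : eqType) (a b : pred T) (L : seq T) x :
  (forall z, a z -> b z) -> x \in L -> b x -> ~~ a x ->
  (count a L < count b L)%N.
Proof.
move=> ab xL bx nax.
have h : (count a L + count (pred1 x) L <= count b L)%N.
  rewrite -count_predUI (@eq_count _ (predI a (pred1 x)) pred0) ?count_pred0 ?addn0.
    by apply: sub_count => z /= /orP[/ab//|/eqP->].
  by move=> z /=; case: (z =P x) => [->|]; rewrite ?(negbTE nax) ?andbF.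
by apply: leq_trans h; rewrite -[X in (X < _)%N]addn0 ltn_add2l -has_count has_pred1.
Qed.

Lemma total_orderE (A : set elt) rho :
  enumerable A -> total_order_on A rho ->
  exists2 f, inj_on A f & rho = key_order A f.
Proof.
move=> [L hL] [rA rI rT rC].
(* The key of [x] counts the entries of [L] below it; repetitions in [L] are harmless. *)
pose f x := count (fun y => `[< rho y x >]) L.
have fmono x y : rho x y -> (f x < f y)%N.
  move=> xy; have [Ax Ay] := rA _ _ xy.
  apply: (@count_lt_sub _ _ _ _ x); last exact/asboolP/rI.
  - by move=> z /asboolP zx; apply/asboolP/(rT _ _ _ zx).
  - exact: hL.
  - exact/asboolP.
exists f.
  move=> x y Ax Ay e; apply: contrapT => nxy.
  by case: (rC _ _ Ax Ay nxy) => /fmono; rewrite e ltnn.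
apply/funext => x; apply/funext => y; apply/propext; split.
  by move=> xy; have [Ax Ay] := rA _ _ xy; split=> //; apply: fmono.
move=> [Ax Ay fxy].
have nxy : x <> y by move=> e; rewrite e ltnn in fxy.
case: (rC _ _ Ax Ay nxy) => // /fmono; lia.
Qed.

Lemma opp_total_order A rho : total_order_on A rho -> total_order_on A (opp_order rho).
Proof.
move=> [rA rI rT rC]; split.
- by move=> x y /rA[].
- by move=> x /rI.
- by move=> x y z yx zy; apply: rT yx.
- by move=> x y Ax Ay /(rC _ _ Ax Ay)[]; [right|left].
Qed.

(** Induction on the difference of the keys: if some [z] lies between [x] and [y], transitivity of
    [sigma] forces a disagreement on [x], [z] or on [z], [y]. *)
Lemma adjacent_disagreement (A : set elt) rho sigma x y :
  enumerable A -> total_order_on A rho -> total_order_on A sigma ->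
  rho x y -> sigma y x -> exists x' y', adjacent rho x' y' /\ sigma y' x'.
Proof.
move=> eA tr [sA sI sT sC].
have [f fI ->] := total_orderE eA tr.
have [m] := ubnP (f y - f x); elim: m x y => // m IH x y hm xy yx.
have [[z [xz zy]]|nz] := pselect (exists z, key_order A f x z /\ key_order A f z y);
  last by exists x, y.
have [Ax Az fxz] := xz; have [_ Ay fzy] := zy.
have nxz : x <> z by move=> e; rewrite e ltnn in fxz.
case: (sC _ _ Ax Az nxz) => h.
  by apply: (IH z y) => //; [lia | apply: sT h].
by apply: (IH x z) => //; lia.
Qed.

(** * Commutation classes *)

(** Since commutation is symmetric, this one-sided condition is symmetric between total orders of
    the same set. *)
Definition agree (n k : nat) (rho sigma : eorder) : Prop :=
  forall x y, rho x y -> ~ commute n k x y -> sigma x y.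

Lemma commuteC n k x y : commute n k x y -> commute n k y x.
Proof. by move=> c K hK hy hx; have [? ?] := c K hK hx hy; split. Qed.

Lemma agree_opp n k rho sigma :
  agree n k rho sigma -> agree n k (opp_order rho) (opp_order sigma).
Proof. by move=> h x y yx nc; apply: h => // /commuteC. Qed.

(** Adjacency is what saves transitivity: every third element lies on the same side of [x] and of
    [y]. *)
Lemma exchange_total A rho x y :
  total_order_on A rho -> adjacent rho x y ->
  total_order_on A (exchange rho x y).
Proof.
move=> [rA rI rT rC] [xy nz].
have nyx : ~ rho y x by move=> /(rT _ _ _ xy)/rI.
have [Ax Ay] := rA _ _ xy.
have nxy : x <> y by move=> e; rewrite e in xy; apply: (rI y).
split.
- by move=> u v [[/rA//]|[-> ->]].
- by move=> u [[/rI//]|[-> /esym]].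
- move=> u v w [[uv n1]|[eu ev]] [[vw n2]|[ev' ew]].
  + left; split; first exact: rT vw.
    by move=> [eu ew]; apply: nz; exists v; rewrite -eu -ew.
  + subst v w; left; split.
      have [e|nux] := pselect (u = x); first by case: n1.
      have [Au _] := rA _ _ uv.
      case: (rC _ _ Au Ax nux) => // xu.
      by case: nz; exists u.
    by move=> [_].
  + subst u v; left; split.
      have [e|nwy] := pselect (w = y); first by case: n2.
      have [_ Aw] := rA _ _ vw.
      case: (rC _ _ Ay Aw (nesym nwy)) => // wy.
      by case: nz; exists w.
    by move=> [/esym].
  + by subst; case: nxy.
- move=> u v Au Av nuv.
  have h a b : rho a b -> exchange rho x y a b \/ exchange rho x y b a.
    move=> ab; have [[-> ->]|ne] := pselect (a = x /\ b = y); first by right; right.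
    by left; left.
  by case: (rC _ _ Au Av nuv) => /h[]; [left|right|right|left].
Qed.

(** * Admissible orders from abstract properties of packets, common to [k = 1] and [k = 2] *)

Section Generic.

Variables (n k : nat).

Let C := CB (J n) k.
Let C' := CB (J n) k.+1.

Hypothesis enumC : enumerable C.
Hypothesis packet_ltP : forall K x y, C' K -> packet_lt k K x y ->
  [/\ packet k K x, packet k K y & rho_min n k x y].
Hypothesis rho_min_total : total_order_on C (rho_min n k).
Hypothesis packet_lt_ex : forall K, C' K -> exists x y, packet_lt k K x y.
Hypothesis component_lt : forall K x y, C' K ->
  clos_refl_sym_trans elt (covers k K) x y ->
  [\/ x = y, packet_lt k K x y | packet_lt k K y x].
(** A comparable pair determines its packet; hence flipping one packet leaves the orientation of all
    others unchanged. *)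
Hypothesis packet_eq : forall K K' x y, C' K -> C' K' ->
  packet_lt k K x y -> packet_lt k K' x y \/ packet_lt k K' y x -> K = K'.

Lemma packet_lt_ncommute K x y :
  C' K -> packet_lt k K x y -> ~ commute n k x y.
Proof. by move=> hK h c; have [px py _] := packet_ltP hK h; have [] := c _ hK px py. Qed.

(** Elements comparable in a packet never commute, so agreement preserves the orientation of every
    packet. *)
Lemma AB_agree rho sigma :
  AB n k rho -> total_order_on C sigma -> agree n k rho sigma -> AB n k sigma.
Proof.
move=> [_ adm] ts h; split=> // K hK.
case: (adm K hK) => e; [left|right] => x y Rxy; apply: h (e _ _ Rxy) _.
  exact: packet_lt_ncommute Rxy.
by move=> /commuteC; apply: packet_lt_ncommute Rxy.
Qed.

(** An admissible order extends one of the two orientations of a packet, and not both, because the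
    packet order is nonempty. *)
Lemma InvN rho K : AB n k rho -> C' K ->
  ~ Inv n k rho K <-> extends rho (packet_lt k K).
Proof.
move=> [[_ rI rT _] adm] hK; split.
  by move=> nI; case: (adm K hK) => // e; case: nI; split.
move=> e [_ e']; have [x [y xy]] := packet_lt_ex hK.
by apply: (rI x); apply: rT (e _ _ xy) (e' _ _ xy).
Qed.

Lemma agree_Inv rho sigma :
  AB n k rho -> AB n k sigma -> agree n k rho sigma -> Inv n k rho = Inv n k sigma.
Proof.
move=> hr hs h; apply/seteqP; split=> K.
  move=> [hK e]; split=> // x y yx; apply: h; first exact: e.
  by move=> /commuteC; apply: packet_lt_ncommute yx.
move=> hI; have [hK _] := hI; apply: contrapT => /(InvN hr hK) e.
apply: (iffRL (InvN hs hK)) hI => x y xy.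
by apply: h; [exact: e | exact: packet_lt_ncommute xy].
Qed.

Lemma elem_equiv_agree rho sigma :
  elem_equiv n k rho sigma -> agree n k rho sigma.
Proof.
move=> [_ _ [x [y [_ c ->]]]] u v uv nc; left; split=> // -[eu ev].
by apply: nc; rewrite eu ev.
Qed.

Lemma clos_Inv rho sigma :
  clos_refl_sym_trans _ (elem_equiv n k) rho sigma ->
  AB n k rho -> AB n k sigma /\ Inv n k rho = Inv n k sigma.
Proof.
have st r s : elem_equiv n k r s -> Inv n k r = Inv n k s.
  by move=> e; have [hr hs _] := e; apply: agree_Inv => //; apply: elem_equiv_agree.
(* Admissibility is put as an equivalence so that the induction passes through the symmetric and
   transitive closure. *)
suff H r s : clos_refl_sym_trans _ (elem_equiv n k) r s ->
    (AB n k r <-> AB n k s) /\ Inv n k r = Inv n k s.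
  by move=> /H[e1 e2] /e1.
elim=> {r s}.
- by move=> r s e; rewrite (st _ _ e); case: e.
- by [].
- by move=> r s _ [-> ->].
- by move=> r s t _ [-> ->] _ [-> ->].
Qed.

(** A bubble sort from [rho] to [sigma]: adjacent elements on which the two orders disagree must
    commute, and exchanging them lowers the count [dis] of disagreements. *)
Lemma agree_clos rho sigma :
  AB n k rho -> total_order_on C sigma -> agree n k rho sigma ->
  clos_refl_sym_trans _ (elem_equiv n k) rho sigma.
Proof.
have [L hL] := enumC => hr ts.
pose dis r := count (fun p => `[< r p.1 p.2 /\ sigma p.2 p.1 >])
                [seq (x, y) | x <- L, y <- L].
have [m] := ubnP (dis rho); elim: m rho hr => // m IH rho hr hm h.
have [tr adm] := hr; have [rA rI rT rC] := tr; have [sA sI sT sC] := ts.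
have [[x [y [xy yx]]]|nd] := pselect (exists x y, rho x y /\ sigma y x); last first.
  suff -> : rho = sigma by apply: rst_refl.
  have nd' x y : rho x y -> sigma x y.
    move=> xy; have [Ax Ay] := rA _ _ xy.
    have nxy : x <> y by move=> e; rewrite e in xy; apply: (rI y).
    by case: (sC _ _ Ax Ay nxy) => // yx; case: nd; exists x, y.
  apply/funext => x; apply/funext => y; apply/propext; split; first exact: nd'.
  move=> xy; have [Ax Ay] := sA _ _ xy.
  have nxy : x <> y by move=> e; rewrite e in xy; apply: (sI y).
  case: (rC _ _ Ax Ay nxy) => // /nd' yx.
  by case: (sI x); apply: sT yx.
have [x' [y' [ad yx']]] := adjacent_disagreement enumC tr ts xy yx.
move: x' y' ad yx' => {xy yx}x {}y ad yx.
have [xy nz] := ad.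
have c : commute n k x y.
  apply: contrapT => nc; apply: (sI x); apply: sT yx.
  exact: h.
have ag : agree n k rho (exchange rho x y).
  by move=> u v uv nc; left; split=> // -[eu ev]; apply: nc; rewrite eu ev.
have te := exchange_total tr ad.
have he := AB_agree hr te ag.
apply: rst_trans (IH _ he _ _).
- by apply: rst_step; split=> //; exists x, y.
- have [Ax Ay] := rA _ _ xy.
  apply: leq_trans (_ : (dis rho <= m)%N); last by lia.
  apply: (@count_lt_sub _ _ _ _ (x, y)).
  + move=> [u v] /= /asboolP[[[uv _]|[-> ->]] vu]; apply/asboolP; first by split.
    by case: (sI x); apply: sT yx.
  + by apply/allpairsP; exists (x, y); split=> //; apply: hL.
  + by apply/asboolP.
  + apply/asboolP => /= -[[[_ nn]|[e _]] _]; first by case: nn.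
    by rewrite e in xy; apply: (rI y).
- move=> u v [[uv _]|[-> ->]] nc; first exact: h.
  by case: nc; apply: commuteC.
Qed.

Lemma cls_eq rho sigma : clos_refl_sym_trans _ (elem_equiv n k) rho sigma ->
  cls n k rho = cls n k sigma.
Proof.
move=> h; apply/seteqP; split=> r /= hr; last exact: rst_trans hr.
by apply: rst_trans hr; apply: rst_sym.
Qed.

Lemma InvB_cls rho : AB n k rho -> InvB n k (cls n k rho) = Inv n k rho.
Proof.
move=> hr; apply/seteqP; split=> K.
  by move=> [s /= hs]; have [_ ->] := clos_Inv hs hr.
by move=> hK; exists rho => //; apply: rst_refl.
Qed.

(** * Packet flips *)

(** The relation hidden in the [let] of [flip], named so that its symmetry and transitivity can be
    used. *)
Definition same (K : elt) : eorder :=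
  fun x y => exists D, [/\ components k K D, D x & D y].

Lemma sameE K x y : same K x y <->
  [/\ packet k K x, packet k K y & clos_refl_sym_trans elt (covers k K) x y].
Proof.
split.
  move=> [D [[z pz ->] [px zx] [py zy]]]; split=> //.
  by apply: rst_trans zy; apply: rst_sym.
move=> [px py xy]; exists [set y | packet k K y /\
   clos_refl_sym_trans elt (covers k K) x y]; split; first by exists x.
  by split=> //; apply: rst_refl.
by split.
Qed.

Lemma same_sym K x y : same K x y -> same K y x.
Proof. by move=> [D [? ? ?]]; exists D. Qed.

Lemma same_trans K x y z : same K x y -> same K y z -> same K x z.
Proof.
by move=> /sameE[? ? xy] /sameE[? ? yz]; apply/sameE; split=> //; apply: rst_trans yz.
Qed.

(** Components are generated by covers only; a packet inequality is refined into a chain of covers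
    by induction on the difference of keys for [rho_min]. *)
Lemma packet_lt_same K x y : C' K -> packet_lt k K x y -> same K x y.
Proof.
move=> hK xy; have [px py _] := packet_ltP hK xy; apply/sameE; split=> //.
have [f _ ef] := total_orderE enumC rho_min_total.
have mono u v : packet_lt k K u v -> (f u < f v)%N.
  by move=> /(packet_ltP hK)[_ _]; rewrite ef => -[].
have [m] := ubnP (f y - f x); elim: m x y xy {px py} => // m IH x y xy hm.
have [[z [xz zy]]|nz] := pselect (exists z, packet_lt k K x z /\ packet_lt k K z y).
  have := mono _ _ xz; have := mono _ _ zy => ? ?.
  by apply: rst_trans (IH _ _ xz _) (IH _ _ zy _); lia.
by apply: rst_step.
Qed.

Lemma same_lt K x y : C' K -> same K x y ->
  [\/ x = y, packet_lt k K x y | packet_lt k K y x].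
Proof. by move=> hK /sameE[_ _]; apply: component_lt. Qed.

Lemma N_same rho K x y z : N n k rho K ->
  same K x z -> rho x y -> rho y z -> same K x y.
Proof.
move=> [hK cons] [D [hD Dx Dz]] xy yz; exists D; split=> //.
exact: cons xy yz.
Qed.

(** In the mixed cases of transitivity, a wrong comparison would place an element outside a
    component between two elements of it, against consecutiveness. *)
Lemma flip_total rho K : total_order_on C rho -> N n k rho K ->
  total_order_on C (flip k K rho).
Proof.
move=> [rA rI rT rC] hN; split.
- by move=> x y [[_ /rA[]]|[_ /rA]].
- by move=> x [[_ /rI]|[_ /rI]].
- move=> x y z; rewrite /flip -!/(same K _ _) => -[[sxy yx]|[nsxy xy]] [[syz zy]|[nsyz yz]].
  + by left; split; [apply: same_trans syz | apply: rT yx].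
  + right; have nsxz : ~ same K x z.
      by move=> sxz; apply: nsyz; apply: same_trans sxz; apply: same_sym.
    split=> //; have [_ Ax] := rA _ _ yx; have [_ Az] := rA _ _ yz.
    have nxz : x <> z by move=> e; apply: nsyz; rewrite -e; apply: same_sym.
    case: (rC _ _ Ax Az nxz) => // zx; case: nsyz.
    exact: (N_same hN (same_sym sxy) yz zx).
  + right; have nsxz : ~ same K x z.
      by move=> sxz; apply: nsxy; apply: same_trans sxz _; apply: same_sym.
    split=> //; have [Ax _] := rA _ _ xy; have [Az _] := rA _ _ zy.
    have nxz : x <> z by move=> e; apply: nsxy; rewrite e; apply: same_sym.
    case: (rC _ _ Ax Az nxz) => // zx; case: nsxy.
    apply: (same_trans (same_sym (N_same hN (same_sym syz) zx xy))).
    exact: same_sym.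
  + right; split; last exact: rT yz.
    by move=> sxz; apply: nsxy; apply: (N_same hN sxz xy yz).
- move=> x y Ax Ay /(rC _ _ Ax Ay) h; rewrite /flip -!/(same K _ _).
  have [s|ns] := pselect (same K x y).
    have s' := same_sym s; case: h; tauto.
  have ns' : ~ same K y x by move=> /same_sym.
  case: h; tauto.
Qed.

Lemma flip_rev rho K x y : C' K -> packet_lt k K x y ->
  (flip k K rho x y <-> rho y x) /\ (flip k K rho y x <-> rho x y).
Proof.
move=> hK /(packet_lt_same hK) s; have s' := same_sym s.
by rewrite /flip -!/(same K _ _); tauto.
Qed.

Lemma flip_AB rho K : AB n k rho -> N n k rho K -> AB n k (flip k K rho).
Proof.
move=> [tr adm] hN; have [hK _] := hN; split; first exact: flip_total.
move=> K' hK'; have [e|ne] := pselect (K = K').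
  subst K'; case: (adm K hK) => e; [right|left] => x y /= xy.
    by apply/(flip_rev rho hK xy).2; apply: e.
  by apply/(flip_rev rho hK xy).1; apply: e.
(* A pair comparable in [K'] and inside one component of [K] would be comparable in [K], forcing
   [K = K']. *)
have ns x y : packet_lt k K' x y -> ~ same K x y.
  move=> xy /(same_lt hK)[e|h|h].
  - have [_ _ ] := packet_ltP hK' xy; have [_ mI _ _] := rho_min_total.
    by rewrite e => /mI.
  - by apply: ne; apply: (packet_eq hK hK' h); left.
  - by apply: ne; apply: (packet_eq hK hK' h); right.
case: (adm K' hK') => e; [left|right] => x y xy; right; split.
- exact: ns xy.
- exact: e.
- by move=> s; apply: (ns _ _ xy); apply: same_sym s.
- exact: e.
Qed.

Lemma flip_opp rho K : flip k K (opp_order rho) = opp_order (flip k K rho).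
Proof.
apply/funext => x; apply/funext => y; apply/propext.
rewrite /opp_order /flip -!/(same K _ _).
have : same K x y <-> same K y x by split; apply: same_sym.
by move=> ->.
Qed.

Lemma flipK rho K : flip k K (flip k K rho) = rho.
Proof.
apply/funext => x; apply/funext => y; apply/propext.
rewrite /flip -!/(same K _ _).
have : same K x y <-> same K y x by split; apply: same_sym.
have := EM (same K x y); tauto.
Qed.

Lemma N_flip rho K : total_order_on C rho -> N n k rho K -> N n k (flip k K rho) K.
Proof.
move=> [rA rI rT rC] hN; have [hK cons] := hN; split=> // D hD x y z Dx Dz xy yz.
have sxz : same K x z by exists D.
have sD u v : D u -> same K u v -> D v.
  case: hD => w pw -> [pu wu] /sameE[_ pv uv]; split=> //.
  exact: rst_trans uv.
have [s|ns] := pselect (same K x y); first exact: sD s.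
have [s|ns'] := pselect (same K y z); first by apply: (sD z) => //; apply: same_sym.
case: xy => [[]//|[_ xy]]; case: yz => [[]//|[_ yz]].
exact: cons xy yz.
Qed.

Lemma N_opp rho K : N n k rho K -> N n k (opp_order rho) K.
Proof. by move=> [hK cons]; split=> // D /cons h x y z Dx Dz xy yz; apply: (h z y x). Qed.

Lemma opp_AB rho : AB n k rho -> AB n k (opp_order rho).
Proof.
move=> [tr adm]; split; first exact: opp_total_order.
by move=> K /adm[] e; [right|left] => x y /e.
Qed.

(** * Extremal classes *)

(** The part of the argument that is specific to each [k]. A total order agreeing with [rho]
    suffices: [AB_agree] makes it admissible and [agree_clos] equivalent to [rho]. The packet found
    may differ from the given one. *)
Hypothesis up_step : forall rho, AB n k rho ->
  (exists2 K, C' K & ~ Inv n k rho K) ->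
  exists sigma K, [/\ total_order_on C sigma, agree n k rho sigma,
                      N n k sigma K & ~ Inv n k rho K].

Lemma rho_min_AB : AB n k (rho_min n k).
Proof. by split=> // K hK; left=> x y /(packet_ltP hK)[]. Qed.

Lemma rho_max_AB : AB n k (rho_max n k).
Proof. exact: opp_AB rho_min_AB. Qed.

Lemma Inv_rho_max K : C' K -> Inv n k (rho_max n k) K.
Proof. by move=> hK; split=> // x y /(packet_ltP hK)[]. Qed.

Lemma Inv_rho_min K : C' K -> ~ Inv n k (rho_min n k) K.
Proof. by move=> hK; apply/(InvN rho_min_AB hK) => x y /(packet_ltP hK)[]. Qed.

(** A non-commuting pair is comparable in some packet, and both [rho] and [rho_max] run against the
    standard order of that packet. *)
Lemma agree_rho_max rho : AB n k rho ->
  (forall K, C' K -> Inv n k rho K) -> agree n k rho (rho_max n k).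
Proof.
move=> [[rA rI rT rC] adm] hI x y xy nc.
have [K hK] : exists2 K, C' K & packet_lt k K x y \/ packet_lt k K y x.
  apply: contrapT => nK; apply: nc => K hK _ _.
  by split=> h; apply: nK; exists K; tauto.
case=> h; last by have [] := packet_ltP hK h.
have [_ /(_ _ _ h) yx] := hI K hK.
by case: (rI x); apply: rT yx.
Qed.

Lemma up_or_max rho : AB n k rho ->
  agree n k rho (rho_max n k) \/
  exists sigma K, [/\ AB n k sigma, agree n k rho sigma,
                      N n k sigma K & ~ Inv n k sigma K].
Proof.
move=> hr; have [hI|nI] := pselect (forall K, C' K -> Inv n k rho K).
  by left; apply: agree_rho_max.
right; have [|s [K [ts ag hN nK]]] := up_step hr.
  apply: contrapT => nex; apply: nI => K hK; apply: contrapT => h.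
  by apply: nex; exists K.
have hs := AB_agree hr ts ag.
by exists s, K; split=> //; rewrite -(agree_Inv hr hs ag).
Qed.

Lemma flip_step sigma K : AB n k sigma -> N n k sigma K -> ~ Inv n k sigma K ->
  stepB n k (cls n k sigma) (cls n k (flip k K sigma)).
Proof.
move=> hs hN nI; split.
- by exists sigma.
- by exists (flip k K sigma) => //; apply: flip_AB.
- exists K; split; last by exists sigma; split=> //; apply: rst_refl.
    by exists sigma => //; apply: rst_refl.
  by rewrite InvB_cls.
Qed.

Lemma Inv_flip sigma K : AB n k sigma -> N n k sigma K -> ~ Inv n k sigma K ->
  Inv n k (flip k K sigma) K.
Proof.
move=> hs [hK _] /(InvN hs hK) e; split=> // x y xy.
by apply/(flip_rev _ hK xy).2; apply: e.
Qed.

(** [Inv] is constant on classes, and it contains [K] only after the flip. *)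
Lemma cls_flip_neq sigma K : AB n k sigma -> N n k sigma K -> ~ Inv n k sigma K ->
  cls n k (flip k K sigma) <> cls n k sigma.
Proof.
move=> hs hN nI e; apply: (nI); rewrite -InvB_cls // -e InvB_cls; last exact: flip_AB.
exact: Inv_flip.
Qed.

Lemma step_not_from_max r : ~ stepB n k (cls n k (rho_max n k)) r.
Proof.
move=> [_ _ [K [[s _ [hK _]] nI _]]]; apply: nI.
by rewrite InvB_cls; [exact: Inv_rho_max | exact: rho_max_AB].
Qed.

(** A step puts its packet into [Inv], which is empty for [rho_min]. *)
Lemma step_not_to_min r : ~ stepB n k r (cls n k (rho_min n k)).
Proof.
move=> [[t ht er] _ [K [_ nI [s [rs hN e]]]]]; have [hK _] := hN.
have hs : AB n k s by move: rs; rewrite er => /= /clos_Inv/(_ ht)[].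
have nIs : ~ Inv n k s K by move=> h; apply: nI; exists s.
apply: (Inv_rho_min hK); rewrite -InvB_cls; last exact: rho_min_AB.
rewrite e InvB_cls; last exact: flip_AB.
exact: Inv_flip.
Qed.

Lemma extremal_classes :
  (forall r, maximal n k r <-> r = cls n k (rho_max n k)) /\
  (forall r, minimal n k r <-> r = cls n k (rho_min n k)).
Proof.
split=> r; split.
- move=> [[rho hr ->] hmax]; have [ag|[s [K [hs ag hN nI]]]] := up_or_max hr.
    by apply: cls_eq; apply: agree_clos => //; have [] := rho_max_AB.
  have ers : cls n k rho = cls n k s.
    by apply: cls_eq; apply: agree_clos => //; have [] := hs.
  (* The class of the flip would lie strictly above a maximal one. *)
  case: (cls_flip_neq hs hN nI); rewrite -ers; apply: hmax.
    by exists (flip k K s) => //; apply: flip_AB.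
  by rewrite ers; apply: rt_step; apply: flip_step.
- move=> ->; split; first by exists (rho_max n k) => //; apply: rho_max_AB.
  by move=> r' _ h; case: (clos_rt_rt1n _ _ _ _ h) => // r1 r2 /step_not_from_max.
- move=> [[rho hr ->] hmin].
  have [e|[s [K [hs ag hN nI]]]] := up_or_max (opp_AB hr).
    apply: cls_eq; apply: agree_clos => //.
    exact: (agree_opp e).
  have [hK _] := hN.
  have hos := opp_AB hs.
  (* Reversal turns the upward step into a downward one: flipping [t] at [K] gives [opp_order s],
     which is equivalent to [rho], so the class of [t] lies strictly below that of [rho]. *)
  set t := opp_order (flip k K s).
  have ht : AB n k t by apply: opp_AB; apply: flip_AB.
  have hNt : N n k t K by apply: N_opp; apply: N_flip => //; have [] := hs.
  have nIt : ~ Inv n k t K.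
    by apply/(InvN ht hK) => x y xy; have [_ e] := Inv_flip hs hN nI; exact: (e y x).
  have eft : flip k K t = opp_order s by rewrite /t flip_opp flipK.
  have er : cls n k rho = cls n k (opp_order s).
    apply: cls_eq; apply: agree_clos => //; first by have [] := hos.
    exact: (agree_opp ag).
  have := cls_flip_neq ht hNt nIt; rewrite eft -er => ne; case: ne; apply: esym.
  apply: hmin; first by exists t.
  by apply: rt_step; rewrite er -eft; apply: flip_step.
- move=> ->; split; first by exists (rho_min n k) => //; apply: rho_min_AB.
  move=> r' _ /(clos_rt_rtn1 _ _ _ _); move e: (cls n k _) => m h.
  by case: h e => // r1 r2 st _ e; case: (@step_not_to_min r1); rewrite e.
Qed.

End Generic.

(** * Crossings of wires *)

Lemma mem_negs (S : {fset int}) x : (x \in negs S) = (- x \in S).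
Proof.
apply/imfsetP/idP => /= [[y yS ->]|h]; first by rewrite opprK.
by exists (- x); rewrite ?opprK.
Qed.

Lemma negsK S : negs (negs S) = S.
Proof. by apply/fsetP => x; rewrite !mem_negs opprK. Qed.

Lemma negs2 u v : negs [fset u; v]%fset = [fset - u; - v]%fset.
Proof. by apply/fsetP => x; rewrite mem_negs !inE; lia. Qed.

Lemma brk_negs S : brk (negs S) = brk S.
Proof. by rewrite /brk negsK fsetUC. Qed.

Lemma brk_inj S S' : brk S = brk S' -> S = S' \/ S = negs S'.
Proof.
move=> [e]; have : S \in [fset S; negs S]%fset by rewrite !inE eqxx.
by rewrite e !inE => /orP[]/eqP; [left|right].
Qed.

Lemma mem_J n x : (x \in J n) = (x != 0) && (`|x| <= n)%N.
Proof.
rewrite !inE; apply/orP/idP.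
  by case=> /imfsetP[/= i]; rewrite mem_iota => hi ->; lia.
move=> h; have [hx|hx] := leP 0 x; [left|right]; apply/imfsetP => /=.
  by exists `|x|%N; rewrite ?mem_iota; lia.
by exists `|x|%N; rewrite ?mem_iota; lia.
Qed.

Lemma JN n x : (- x \in J n) = (x \in J n).
Proof. by rewrite !mem_J; lia. Qed.

Lemma fset2_inj (u v c d : int) : [fset u; v]%fset = [fset c; d]%fset ->
  (u = c /\ v = d) \/ (u = d /\ v = c).
Proof.
move=> /fsetP e; have := e u; have := e v; have := e c; have := e d.
by rewrite !inE; lia.
Qed.

Lemma cardfsSP (S : {fset int}) m : #|` S| = m.+1 ->
  exists a A, [/\ a \notin A, S = (a |` A)%fset & #|` A| = m].
Proof.
move=> cS; have [a aS] : exists a, a \in S.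
  by apply/fset0Pn; rewrite -cardfs_eq0 cS.
exists a, (S `\ a)%fset; rewrite !inE eqxx fsetD1K //; split=> //.
by move: cS; rewrite (cardfsD1 a) aS => -[].
Qed.

Lemma cardfs2E (S : {fset int}) : #|` S| = 2%N ->
  exists u v, u < v /\ S = [fset u; v]%fset.
Proof.
move=> /cardfsSP[u [A [uA -> /eqP/cardfs1P[v eA]]]]; subst A.
have [h|h] : u < v \/ v < u by move: uA; rewrite !inE; lia.
  by exists u, v.
by exists v, u; rewrite fsetUC.
Qed.

(* The wires [u] and [v] cross simultaneously with [- u] and [- v]; the
   crossing of [a] with [- a] is the element [a,*]. *)
Definition X (u v : int) : elt :=
  if u == - v then Star [fset `|u|]%fset else brk [fset u; v]%fset.

Lemma XC u v : X u v = X v u.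
Proof.
rewrite /X; have [->|e] := eqVneq u (- v); first by rewrite opprK eqxx normrN.
by case: eqP => [h|_]; [lia | rewrite fsetUC].
Qed.

Lemma XN u v : X (- u) (- v) = X u v.
Proof. by rewrite /X eqr_opp normrN -negs2 brk_negs. Qed.

Lemma XNr u v : X u (- v) = X (- u) v.
Proof. by rewrite -[in RHS]XN opprK. Qed.

Lemma X_inj u v c d : X u v = X c d ->
  (u = c /\ v = d) \/ (u = d /\ v = c) \/
  (u = - c /\ v = - d) \/ (u = - d /\ v = - c).
Proof.
rewrite /X; case: eqP => h; case: eqP => h' //.
  move=> [] /fset1_inj; lia.
move=> /brk_inj[]; rewrite ?negs2 => /fset2_inj; lia.
Qed.

(** Serves both for [J n] and for the wires [T] and [negs T] of the packet of [Star T]; excluding 0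
    keeps a wire distinct from its opposite. *)
Definition wires_symmetric (E : {fset int}) : Prop :=
  forall x, x \in E -> x != 0 /\ - x \in E.

Lemma J_symmetric n : wires_symmetric (J n).
Proof. by move=> x hx; rewrite JN; move: hx; rewrite mem_J; lia. Qed.

(** An element [a,*] is the crossing of [- a] and [a], so one description covers both [CB1] and
    [CB2]. *)
Lemma CB_pairP E x : wires_symmetric E ->
  CB E 2 x <-> exists u v, [/\ u \in E, v \in E, u < v & x = X u v].
Proof.
move=> sE; split.
  case=> [[S [SE c2 Sinj ->]]|[T [TE cT ->]]].
    have [u [v [uv eS]]] := cardfs2E c2.
    have hu : u \in S by rewrite eS !inE eqxx.
    have hv : v \in S by rewrite eS !inE eqxx orbT.
    have hX : brk S = X u v.
      rewrite /X; case: eqP => [e|_]; last by rewrite eS.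
      have : u = v by apply: Sinj => //; rewrite e abszN.
      lia.
    by exists u, v; split=> //; apply: (fsubsetP SE).
  have /cardfs1P[a eT] : #|` T| == 1%N by move: cT => [->].
  have : a \in T by rewrite eT !inE.
  move=> /(fsubsetP TE); rewrite !inE /= => /andP[aE a0].
  exists (- a), a; have [_ naE] := sE _ aE; split=> //; first lia.
  by rewrite /X eqxx eT normrN ger0_norm // ltW.
move=> [u [v [uE vE uv ->]]]; rewrite /X; case: eqP => e.
  right; exists [fset `|u|]%fset; split=> //; last by rewrite cardfs1.
  apply/fsubsetP => z; rewrite !inE /= => /eqP ->.
  have -> : `|u| = v by lia.
  by rewrite vE; lia.
left; exists [fset u; v]%fset; split=> //.
- by apply/fsubsetP => z; rewrite !inE => /orP[]/eqP ->.
- by rewrite cardfs2; lia.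
- by move=> a b; rewrite !inE; lia.
Qed.

Lemma rst_sub (T : Type) (R Q : T -> T -> Prop) x y :
  (forall u v, R u v -> Q u v) -> (forall u, Q u u) ->
  (forall u v, Q u v -> Q v u) ->
  (forall u v w, Q u v -> Q v w -> Q u w) ->
  clos_refl_sym_trans T R x y -> Q x y.
Proof. by move=> h1 h2 h3 h4; elim=> {x y}; eauto. Qed.

(** * The case k = 1 *)

Lemma CB_singleP E x : CB E 1 x <-> exists2 a, a \in E & x = Single a.
Proof. by split=> [[a /= aE <-]|[a aE ->]]; exists a. Qed.

Lemma packet1P u v x : u < v -> u != 0 -> v != 0 -> packet 1 (X u v) x <->
  exists2 c, x = Single c & c = u \/ c = v \/ c = - u \/ c = - v.
Proof.
move=> uv u0 v0; rewrite /X; case: eqP => e.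
  rewrite /packet CB_singleP; split.
    move=> [a]; rewrite !inE mem_negs !inE => h ->; exists a => //.
    lia.
  by move=> [c -> h]; exists c => //; rewrite !inE mem_negs !inE; lia.
rewrite /packet /=; split.
  move=> [S [a [hS aS ->]]]; exists a => //; move: hS; rewrite !inE.
  case/orP=> /eqP eS; move: aS; rewrite eS ?mem_negs !inE; lia.
move=> [c -> h].
have [hc|hc] : c = u \/ c = v \/ c = - u \/ c = - v by tauto.
  by exists [fset u; v]%fset, c; rewrite !inE eqxx hc eqxx.
have [hc'|hc'] : c = v \/ (c = - u \/ c = - v) by tauto.
  by exists [fset u; v]%fset, c; rewrite !inE eqxx hc' eqxx orbT.
exists (negs [fset u; v]%fset), c; rewrite mem_negs !inE eqxx orbT.
by split=> //; lia.
Qed.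

(** The entry [j] of the preferred representative is [u] or [- v], whichever wire has the greater
    absolute value, and both choices give the same two relations. When [u = - v] these two coincide
    in the single relation of [a,*]. *)
Lemma packet_lt1P u v x y : u < v -> u != 0 -> v != 0 ->
  packet_lt1 (X u v) x y <->
  (x = Single u /\ y = Single v) \/ (x = Single (- v) /\ y = Single (- u)).
Proof.
move=> uv u0 v0; split.
  case=> [[j [i [e j0 ij h]]]|[a [a0 e -> ->]]].
    have {}e : X u v = X j i by rewrite e /X; case: eqP => //; lia.
    case: (X_inj e) => [|[|[|]]] -[? ?]; subst; rewrite ?opprK; case: h => -[-> ->]; rewrite ?opprK; try tauto; lia.
  have {}e : X u v = X (- a) a by rewrite e /X eqxx normrN ger0_norm // ltW.
  by left; case: (X_inj e) => [|[|[|]]] -[? ?]; subst; rewrite ?opprK //; lia.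
have [e|[e|e]] : u = - v \/ `|v| < `|u| \/ `|u| < `|v| by lia.
- subst u; rewrite opprK => h; right; exists v; split; rewrite /X ?eqxx ?normrN.
  + lia.
  + by rewrite ger0_norm //; lia.
  + by case: h => -[].
  + by case: h => -[].
- move=> h; left; exists u, v; split=> //; first by rewrite /X; case: eqP => //; lia.
  lia.
- move=> h; left; exists (- v), (- u); rewrite !normrN !opprK; split=> //.
  + by rewrite -negs2 brk_negs /X fsetUC; case: eqP => //; lia.
  + lia.
  + tauto.
Qed.

Lemma CB_J_pairP n x : CB (J n) 2 x <->
  exists u v, [/\ u \in J n, v \in J n, u < v & x = X u v].
Proof. exact/CB_pairP/J_symmetric. Qed.

Lemma J_neq0 n u : u \in J n -> u != 0.
Proof. by case/J_symmetric. Qed.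

Lemma enumerable_CB1 n : enumerable (CB (J n) 1).
Proof.
exists [seq Single a | a <- J n] => x /CB_singleP[a aJ ->].
exact: map_f.
Qed.

Lemma enumerable_CB2 n : enumerable (CB (J n) 2).
Proof.
exists [seq X u v | u <- J n, v <- J n] => x /CB_J_pairP[u [v [uJ vJ _ ->]]].
by apply/allpairsP; exists (u, v).
Qed.

Lemma packet_lt1_inv n K x y : CB (J n) 2 K -> packet_lt 1 K x y ->
  exists a b, [/\ a \in J n, b \in J n, a < b, x = Single a /\ y = Single b & K = X a b].
Proof.
move=> /CB_J_pairP[u [v [uJ vJ uv ->]]].
case/(packet_lt1P _ _ uv (J_neq0 uJ) (J_neq0 vJ)) => -[-> ->].
  by exists u, v.
exists (- v), (- u); rewrite !JN XN XC; split=> //; lia.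
Qed.

Lemma packet_lt1_X a b : a < b -> a != 0 -> b != 0 ->
  packet_lt 1 (X a b) (Single a) (Single b).
Proof. by move=> ab a0 b0; apply/(packet_lt1P _ _ ab a0 b0); left. Qed.

Lemma packet_lt1_packet n K x y : CB (J n) 2 K -> packet_lt 1 K x y ->
  [/\ packet 1 K x, packet 1 K y & rho_min n 1 x y].
Proof.
move=> hK /(packet_lt1_inv hK)[a [b [aJ bJ ab [-> ->] ->]]].
have hp z := packet1P z ab (J_neq0 aJ) (J_neq0 bJ).
split; [apply/hp; exists a; tauto | apply/hp; exists b; tauto |].
by split; [apply/CB_singleP; exists a | apply/CB_singleP; exists b | exists a, b].
Qed.

Lemma rho_min1_total n : total_order_on (CB (J n) 1) (rho_min n 1).
Proof.
split.
- by move=> x y [].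
- by move=> x [_ _ [a [b [-> [->]]]]]; rewrite ltxx.
- move=> x y z [Ax Ay [a [b [ex ey ab]]]] [_ Az [b' [c [ey' ez bc]]]].
  split=> //.
  exists a, c; split=> //; move: ey; rewrite ey' => -[eb]; lia.
- move=> x y /[dup] Ax /CB_singleP[a aJ ex] /[dup] Ay /CB_singleP[b bJ ey] nxy.
  have nab : a <> b by move=> e; apply: nxy; rewrite ex ey e.
  have [h|h] : a < b \/ b < a by lia.
    by left; split=> //; exists a, b.
  by right; split=> //; exists b, a.
Qed.

Lemma component_lt1 n K x y : CB (J n) 2 K ->
  clos_refl_sym_trans elt (covers 1 K) x y ->
  [\/ x = y, packet_lt 1 K x y | packet_lt 1 K y x].
Proof.
move=> /CB_J_pairP[u [v [uJ vJ uv ->]]].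
have u0 := J_neq0 uJ; have v0 := J_neq0 vJ.
have P := packet_lt1P _ _ uv u0 v0.
(* As [u < v] and neither is 0, two packet relations never compose, so [Q] is already an equivalence
   relation. *)
pose Q a b := [\/ a = b, packet_lt1 (X u v) a b | packet_lt1 (X u v) b a].
apply: (@rst_sub _ _ Q).
- by move=> a b [ab _]; constructor 2.
- by constructor 1.
- by move=> a b [->|ab|ba]; [constructor 1 | constructor 3 | constructor 2].
- move=> a b c [->//|/P ab|/P ba] [<-|/P bc|/P cb].
  + by constructor 2; apply/P.
  + by case: ab bc => -[-> ->] [] [] [] ? ->; have : False by lia.
  + constructor 1; case: ab cb => -[-> ->] [] [->] // [?]; congr Single; lia.
  + by constructor 3; apply/P.
  + constructor 1; case: ba bc => -[-> ->] [] [] // [?] ->; congr Single; lia.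
  + by case: ba cb => -[-> ->] [] [] -> [] ?; have : False by lia.
Qed.

Lemma packet_eq1 n K K' x y : CB (J n) 2 K -> CB (J n) 2 K' ->
  packet_lt 1 K x y -> packet_lt 1 K' x y \/ packet_lt 1 K' y x -> K = K'.
Proof.
move=> hK hK' /(packet_lt1_inv hK)[a [b [_ _ _ [-> ->] ->]]] [] /(packet_lt1_inv hK')
  [a' [b' [_ _ _ [[->] [->]] ->]]] //.
by rewrite XC.
Qed.

Lemma packet_lt1_ex n K : CB (J n) 2 K -> exists x y, packet_lt 1 K x y.
Proof.
move=> /CB_J_pairP[u [v [uJ vJ uv ->]]].
by exists (Single u), (Single v); apply: packet_lt1_X => //; apply: J_neq0; eassumption.
Qed.

(* An admissible order is compatible with negation, so that if [a < b] are
   adjacent in it, both components of the packet of [[a,b]] are chains. *)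
Lemma up_step1 n rho : AB n 1 rho ->
  (exists2 K, CB (J n) 2 K & ~ Inv n 1 rho K) ->
  exists sigma K, [/\ total_order_on (CB (J n) 1) sigma, agree n 1 rho sigma,
                      N n 1 sigma K & ~ Inv n 1 rho K].
Proof.
move=> [tr adm] [K hK nI]; have [rA rI rT rC] := tr.
(* A disagreement with [rho_max] is a pair still in increasing order; a non-inverted packet supplies
   one. *)
have {nI} [x [y [xy yx]]] : exists x y, rho x y /\ rho_max n 1 y x.
  have e : extends rho (packet_lt 1 K).
    by case: (adm K hK) => // e; case: nI.
  have [x [y xy]] := packet_lt1_ex hK; exists x, y; split; first exact: e.
  by have [] := packet_lt1_packet hK xy.
have [x' [y' [[ad nz] yx']]] := adjacent_disagreement (enumerable_CB1 n) tr
  (opp_total_order (rho_min1_total n)) xy yx.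
have [_ _ [a [b [ex ey ab]]]] := yx'; subst x' y' => {K hK xy yx x y}.
have [/CB_singleP[a' aJ [ea]] /CB_singleP[b' bJ [eb]]] := rA _ _ ad; subst a' b'.
(* Both relations of a packet are extended in the same direction, so negation reverses [rho]. *)
have flipr c d : rho (Single c) (Single d) -> rho (Single (- d)) (Single (- c)).
  move=> cd; have [/CB_singleP[c' cJ [ec]] /CB_singleP[d' dJ [ed]]] := rA _ _ cd.
  subst c' d'.
  have main p q : p \in J n -> q \in J n -> p < q ->
    (rho (Single p) (Single q) -> rho (Single (- q)) (Single (- p))) /\
    (rho (Single q) (Single p) -> rho (Single (- p)) (Single (- q))).
    move=> pJ qJ pq.
    have hX : CB (J n) 2 (X p q) by apply/CB_J_pairP; exists p, q.
    have P1 := packet_lt1_X pq (J_neq0 pJ) (J_neq0 qJ).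
    have P2 : packet_lt 1 (X p q) (Single (- q)) (Single (- p)).
      by apply/(packet_lt1P _ _ pq (J_neq0 pJ) (J_neq0 qJ)); right.
    case: (adm _ hX) => e; have := e _ _ P1; have := e _ _ P2.
      by split=> // qp; case: (rI (Single q)); apply: rT qp _.
    move=> h1 h2; split=> // qp; case: (rI (Single q)); exact: rT h2 qp.
  have [h|[h|h]] : c = d \/ c < d \/ d < c by lia.
  - by case: (rI (Single c)); rewrite [in X in rho _ X]h.
  - exact: (main _ _ cJ dJ h).1.
  - exact: (main _ _ dJ cJ h).2.
have hX : CB (J n) 2 (X a b) by apply/CB_J_pairP; exists a, b.
have Pab := packet_lt1P _ _ ab (J_neq0 aJ) (J_neq0 bJ).
exists rho, (X a b); split=> //.
  split=> // D hD x y z Dx Dz xy yz.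
  have [xz|xz|zx] : [\/ x = z, packet_lt 1 (X a b) x z | packet_lt 1 (X a b) z x].
  - apply: component_lt1 hX _; case: hD Dx Dz => w pw -> [_ wx] [_ wz].
    by apply: rst_trans wz; apply: rst_sym.
  - by case: (rI x); rewrite [in X in rho _ X]xz; apply: rT yz.
  - case/Pab: xz => -[ex ez]; subst x z.
      by case: nz; exists y.
    have [_ /CB_singleP[c cJ ec]] := rA _ _ xy; subst y.
    (* An element between [- b] and [- a] has its negative between the adjacent [a] and [b]. *)
    case: nz; exists (Single (- c)).
    by move: (flipr _ _ xy) (flipr _ _ yz); rewrite !opprK.
  - have h : rho x z by apply: rT yz.
    case/Pab: zx => -[ez ex]; subst x z.
      by case: (rI (Single a)); apply: rT ad h.
    by case: (rI (Single a)); apply: rT ad _; have := flipr _ _ h; rewrite !opprK.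
move=> [_ /(_ (Single b) (Single a))]; rewrite /opp_order => h.
case: (rI (Single a)); apply: rT ad (h _).
exact: packet_lt1_X ab (J_neq0 aJ) (J_neq0 bJ).
Qed.

(** * The case k = 2 *)

(** For nonzero [u < v], the preferred representative listed increasingly: the sign of [u + v] tells
    which entry has the greater absolute value, and the sum 0 is the case [a,*]. *)
Definition rep (u v : int) : int * int := if u + v <= 0 then (u, v) else (- v, - u).

Lemma X_rep u v : X (rep u v).1 (rep u v).2 = X u v.
Proof. by rewrite /rep; case: ifP => //= _; rewrite XN XC. Qed.

Lemma preferred2 (p q : int) : p < q ->
  preferred [fset p; q]%fset <-> p < 0 /\ `|q| <= `|p|.
Proof.
move=> pq; split.
  move=> [m]; rewrite !inE => mpq [m0 hm].
  have := hm p; have := hm q; rewrite !inE !eqxx orbT => /(_ isT) ? /(_ isT) ?.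
  lia.
move=> [p0 qp]; exists p; first by rewrite !inE eqxx.
by split=> // a; rewrite !inE; lia.
Qed.

Lemma pair_repP u v p : u < v -> u != 0 -> v != 0 ->
  pair_rep (X u v) p <-> p = rep u v.
Proof.
case: p => p q uv u0 v0; split.
  case=> /= [[e [pref pq]]|[a [a0 e [-> ->]]]].
    move: pref => /(preferred2 pq) [p0 qp].
    have npq : p <> - q.
      move=> h; move: e; rewrite /X; case: eqP => // uNv /brk_inj[];
      rewrite ?negs2 => /fset2_inj; lia.
    have {}e : X u v = X p q by rewrite e /X; case: eqP.
    have := X_inj e; rewrite /rep; case: ifP => h hX; congr pair; lia.
  have {}e : X u v = X (- a) a by rewrite e /X eqxx normrN gtr0_norm.
  by have := X_inj e; rewrite /rep; case: ifP => h hX; congr pair; lia.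
have [h|h] := eqVneq u (- v).
  subst u; rewrite /rep addNr lexx => -[-> ->]; right; exists v.
  rewrite /X eqxx normrN; split=> //; first lia.
  by rewrite gtr0_norm //; lia.
have eX : X u v = brk [fset u; v]%fset by rewrite /X; case: eqP => // e; lia.
rewrite /rep; case: ifP => huv [-> ->]; left=> /=.
  by split=> //; split=> //; apply/preferred2 => //; lia.
split; first by rewrite -[in RHS]negs2 brk_negs fsetUC // -eX.
by split; last lia; apply/preferred2; lia.
Qed.

Lemma std_lt2_X u v c d :
  u < v -> u != 0 -> v != 0 -> c < d -> c != 0 -> d != 0 ->
  std_lt2 (X u v) (X c d) <-> pair_lt (rep u v) (rep c d).
Proof.
move=> uv u0 v0 cd c0 d0; split.
  by move=> [p [q [/(pair_repP _ uv u0 v0) -> /(pair_repP _ cd c0 d0) ->]]].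
move=> h; exists (rep u v), (rep c d); split=> //.
  exact/pair_repP.
exact/pair_repP.
Qed.

Lemma pair_lt_irr p : pair_lt p p = false.
Proof. by case: p => p q; rewrite /pair_lt; case: (both_neg _) => /=; lia. Qed.

Lemma pair_lt_trans p q r : pair_lt p q -> pair_lt q r -> pair_lt p r.
Proof.
case: p q r => [p p'] [q q'] [r r']; rewrite /pair_lt.
by do 3 case: (both_neg _) => //=; lia.
Qed.

Lemma pair_lt_total p q : p <> q -> pair_lt p q \/ pair_lt q p.
Proof.
case: p q => [p p'] [q q'] h; rewrite /pair_lt.
have {}h : p <> q \/ p' <> q'.
  have [e|] := eqVneq p q; last by move/eqP; left.
  by right=> e'; apply: h; rewrite e e'.
by do 2 case: (both_neg _) => //=; lia.
Qed.

Lemma rho_min2_total n : total_order_on (CB (J n) 2) (rho_min n 2).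
Proof.
split.
- by move=> x y [].
- move=> x [/CB_J_pairP[u [v [uJ vJ uv ->]]] _].
  have u0 := J_neq0 uJ; have v0 := J_neq0 vJ.
  by move=> /(std_lt2_X uv u0 v0 uv u0 v0); rewrite pair_lt_irr.
- move=> x y z [hx /CB_J_pairP[u [v [uJ vJ uv ->]]] [p [q [hp hq pq]]]].
  move=> [_ hz [q' [r [hq' hr qr]]]]; split=> //; exists p, r; split=> //.
  have u0 := J_neq0 uJ; have v0 := J_neq0 vJ.
  move: hq hq' => /(pair_repP _ uv u0 v0) eq /(pair_repP _ uv u0 v0) eq'.
  by apply: pair_lt_trans pq _; rewrite eq -eq'.
- move=> x y hx hy; have := hy; have := hx.
  move=> /CB_J_pairP[u [v [uJ vJ uv ex]]] /CB_J_pairP[c [d [cJ dJ cd ey]]] nxy.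
  have u0 := J_neq0 uJ; have v0 := J_neq0 vJ.
  have c0 := J_neq0 cJ; have d0 := J_neq0 dJ.
  have [|h|h] := @pair_lt_total (rep u v) (rep c d).
  + by move=> e; apply: nxy; rewrite ex ey -X_rep e X_rep.
  + by left; split=> //; rewrite ex ey; apply/std_lt2_X.
  + by right; split=> //; rewrite ex ey; apply/std_lt2_X.
Qed.

(** * Packets for [k = 2] described by triples of wires *)

Lemma cardfs3 (u v w : int) : u < v -> v < w -> #|` [fset u; v; w]%fset| = 3%N.
Proof.
move=> uv vw; have -> : [fset u; v; w]%fset = (w |` [fset u; v])%fset.
  by apply/fsetP => z; rewrite !inE; lia.
by rewrite cardfsU1 cardfs2 !inE; lia.
Qed.

Lemma fset3_sub (u v w : int) (E : {fset int}) : u \in E -> v \in E -> w \in E ->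
  ([fset u; v; w] `<=` E)%fset.
Proof.
by move=> uE vE wE; apply/fsubsetP => z; rewrite !inE => /orP[/orP[]|] /eqP ->.
Qed.

Lemma fset2_sub (u v : int) (E : {fset int}) : u \in E -> v \in E ->
  ([fset u; v] `<=` E)%fset.
Proof. by move=> uE vE; apply/fsubsetP => z; rewrite !inE => /orP[] /eqP ->. Qed.

Lemma mem_posp E x : (x \in posp E) = (x \in E) && (0 < x).
Proof. by rewrite !inE. Qed.

Lemma cardfs3E (S : {fset int}) : #|` S| = 3%N ->
  exists u v w, [/\ u < v, v < w & S = [fset u; v; w]%fset].
Proof.
move=> /cardfsSP[a [A [aA -> /cardfs2E[b [c [bc eA]]]]]]; move: aA; rewrite eA !inE => h.
have [ab|[[ba ac]|ca]] : a < b \/ (b < a /\ a < c) \/ c < a by lia.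
- by exists a, b, c; split=> //; apply/fsetP => z; rewrite !inE; lia.
- by exists b, a, c; split=> //; apply/fsetP => z; rewrite !inE; lia.
- by exists b, c, a; split=> //; apply/fsetP => z; rewrite !inE; lia.
Qed.

(* Replacing a set of representatives by its opposite, the wire of median
   height may be taken negative.  For [[a,b,*]] the triple consists of three of
   the wires a, b, -a, -b, the one of greatest height being redundant. *)
Definition triple (u v w : int) (K : elt) : Prop :=
  [/\ u < v, v < w, v < 0, w != 0 &
   [/\ `|u| <> `|v|, `|u| <> `|w|, `|v| <> `|w| & K = brk [fset u; v; w]%fset]
   \/ (w = - u /\ K = Star [fset - u; - v]%fset)].

Lemma CB_tripleP n K : CB (J n) 3 K <->
  exists u v w, [/\ u \in J n, v \in J n, w \in J n & triple u v w K].
Proof.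
split.
  case=> [[S [SJ c3 Sinj ->]]|[T [TJ cT ->]]].
    have [u [v [w [uv vw eS]]]] := cardfs3E c3; subst S.
    have uS : u \in [fset u; v; w]%fset by rewrite !inE eqxx.
    have vS : v \in [fset u; v; w]%fset by rewrite !inE eqxx orbT.
    have wS : w \in [fset u; v; w]%fset by rewrite !inE eqxx orbT.
    have uJ := fsubsetP SJ _ uS; have vJ := fsubsetP SJ _ vS; have wJ := fsubsetP SJ _ wS.
    have n1 : `|u| <> `|v| by move=> e; have := Sinj u v uS vS; lia.
    have n2 : `|u| <> `|w| by move=> e; have := Sinj u w uS wS; lia.
    have n3 : `|v| <> `|w| by move=> e; have := Sinj v w vS wS; lia.
    have u0 := J_neq0 uJ; have v0 := J_neq0 vJ; have w0 := J_neq0 wJ.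
    have [v_lt0|v_gt0] : v < 0 \/ 0 < v by lia.
      by exists u, v, w; split=> //; split=> //; left.
    (* A positive median becomes negative in the opposite representative. *)
    exists (- w), (- v), (- u); rewrite !JN; split=> //.
    split; try lia; left; rewrite !normrN; split; try by move=> e; lia.
    rewrite -brk_negs; congr brk; apply/fsetP => z; rewrite mem_negs !inE; lia.
  have /cardfs2E[a [b [ab eT]]] : #|` T| = 2%N by case: cT.
  have /(fsubsetP TJ) : a \in T by rewrite eT !inE eqxx.
  have /(fsubsetP TJ) : b \in T by rewrite eT !inE eqxx orbT.
  rewrite !mem_posp => /andP[bJ b0] /andP[aJ a0].
  exists (- b), (- a), b; rewrite !JN; split=> //.
  by split; try lia; right; rewrite !opprK fsetUC eT.
move=> [u [v [w [uJ vJ wJ [uv vw v0 w0]]]]] [[n1 n2 n3 ->]|[ew ->]].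
  left; exists [fset u; v; w]%fset; split=> //.
  - exact: fset3_sub.
  - by apply: cardfs3; lia.
  - by move=> a b; rewrite !inE; lia.
right; exists [fset - u; - v]%fset; split=> //; last by rewrite cardfs2; lia.
by apply: fset2_sub; rewrite mem_posp JN ?uJ ?vJ; lia.
Qed.

Lemma packet2_brk W x : {in W &, injective absz} ->
  packet 2 (brk W) x <-> exists u v, [/\ u \in W, v \in W, u < v & x = X u v].
Proof.
move=> Winj; split.
  move=> [S [S' [hS SS' /cardfs2E[p [q [pq eS']]] ->]]].
  have pS : p \in S by apply: (fsubsetP SS'); rewrite eS' !inE eqxx.
  have qS : q \in S by apply: (fsubsetP SS'); rewrite eS' !inE eqxx orbT.
  have eX : p <> - q -> brk S' = X p q by rewrite /X eS'; case: eqP.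
  move: hS; rewrite !inE => /orP[] /eqP eS; move: pS qS; rewrite eS ?mem_negs => pS qS.
    exists p, q; split=> //; apply: eX => e.
    by have := Winj p q pS qS; lia.
  exists (- q), (- p); rewrite XN XC; split=> //; first lia.
  by apply: eX => e; have := Winj _ _ pS qS; lia.
move=> [u [v [uW vW uv ->]]]; exists W, [fset u; v]%fset; split=> //.
- by rewrite !inE eqxx.
- exact: fset2_sub.
- by rewrite cardfs2; lia.
- by rewrite /X; case: eqP => // e; have := Winj _ _ uW vW; lia.
Qed.

(** For [a,b,*], the wire [- v] missing from the triple adds only its crossing with [v]: by symmetry
    its crossings with [u] and [w] are those of [v] with [w] and [u]. *)
Lemma triple_packet u v w K x : triple u v w K ->
  packet 2 K x <-> x = X u v \/ x = X u w \/ x = X v w \/ (w = - u /\ x = X v (- v)).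
Proof.
move=> [uv vw v0 w0 [[n1 n2 n3 ->]|[ew ->]]].
  rewrite packet2_brk; last by move=> a b; rewrite !inE; lia.
  split.
    move=> [p [q [pW qW pq ->]]]; move: pW qW; rewrite !inE => pW qW.
    have [[-> ->]|[[-> ->]|[-> ->]]] : (p = u /\ q = v) \/ (p = u /\ q = w) \/
      (p = v /\ q = w) by lia.
    + by left.
    + by right; left.
    + by right; right; left.
  case=> [->|[->|[->|[e]]]]; last by lia.
  - by exists u, v; rewrite !inE !eqxx orbT; split.
  - by exists u, w; rewrite !inE !eqxx !orbT; split=> //; lia.
  - by exists v, w; rewrite !inE !eqxx !orbT; split.
subst w; rewrite /packet CB_pairP; last first.
  by move=> z; rewrite !inE !mem_negs !inE; lia.
split.
  move=> [p [q [pW qW pq ->]]]; move: pW qW; rewrite !inE !mem_negs !inE => pW qW.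
  have {pW} hp : p = u \/ p = v \/ p = - v \/ p = - u by lia.
  have {qW} hq : q = u \/ q = v \/ q = - v \/ q = - u by lia.
  case: hp => [|[|[|]]] ep; case: hq => [|[|[|]]] eq; subst p q; try lia.
  - by left.
  - by right; right; left; rewrite XNr XC.
  - by right; left.
  - by right; right; right.
  - by right; right; left.
  - by left; rewrite XN XC.
case=> [->|[->|[->|[_ ->]]]].
- by exists u, v; rewrite !inE !mem_negs !inE; split=> //; lia.
- by exists u, (- u); rewrite !inE !mem_negs !inE; split=> //; lia.
- by exists v, (- u); rewrite !inE !mem_negs !inE; split=> //; lia.
- by exists v, (- v); rewrite !inE !mem_negs !inE; split=> //; lia.
Qed.

Lemma std_triple u v w : u < v -> v < w -> v < 0 -> w != 0 ->
  std_lt2 (X u v) (X u w) /\ std_lt2 (X u w) (X v w).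
Proof.
move=> uv vw v0 w0; split; apply/std_lt2_X; try lia;
  rewrite /rep; do 2 case: ifP => ?; rewrite /pair_lt /both_neg /=;
  do 2 case: ifP => ?; lia.
Qed.

Lemma triple_lt u v w K : triple u v w K ->
  [/\ packet_lt 2 K (X u v) (X u w), packet_lt 2 K (X u w) (X v w) &
      (w = - u -> packet_lt 2 K (X v w) (X v (- v)))].
Proof.
move=> h; have [uv vw v0 w0 _] := h; have [s1 s2] := std_triple uv vw v0 w0.
have P x := triple_packet x h.
split; [split=> //; apply/P; tauto | split=> //; apply/P; tauto |].
move=> ew; split; [apply/P; tauto | apply/P; tauto |].
(* With [w = - u], [X v w] is [X u (- v)], which the triple [u], [v], [- v] compares with
   [X v (- v)]. *)
have [||||_ s] := @std_triple u v (- v); try lia.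
by rewrite ew XNr XC.
Qed.

Lemma packet_triple_CB n u v w K x : u \in J n -> v \in J n -> w \in J n ->
  triple u v w K -> packet 2 K x -> CB (J n) 2 x.
Proof.
move=> uJ vJ wJ h /(triple_packet _ h) hx; have [uv vw v0 w0 _] := h.
apply/CB_J_pairP; case: hx => [->|[->|[->|[_ ->]]]].
- by exists u, v.
- by exists u, w; split=> //; lia.
- by exists v, w.
- by exists v, (- v); rewrite JN; split=> //; lia.
Qed.

Lemma packet_lt2_packet n K x y : CB (J n) 3 K -> packet_lt 2 K x y ->
  [/\ packet 2 K x, packet 2 K y & rho_min n 2 x y].
Proof.
move=> /CB_tripleP[u [v [w [uJ vJ wJ h]]]] [px py xy]; split=> //; split=> //.
  exact: packet_triple_CB h px.
exact: packet_triple_CB h py.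
Qed.

Lemma packet_lt2_total n K x y : CB (J n) 3 K -> packet 2 K x -> packet 2 K y ->
  [\/ x = y, packet_lt 2 K x y | packet_lt 2 K y x].
Proof.
move=> /CB_tripleP[u [v [w [uJ vJ wJ h]]]] px py.
have hx := packet_triple_CB uJ vJ wJ h px; have hy := packet_triple_CB uJ vJ wJ h py.
have [e|ne] := pselect (x = y); first by constructor 1.
have [_ _ _ tot] := rho_min2_total n.
by case: (tot _ _ hx hy ne) => -[_ _ s]; [constructor 2 | constructor 3].
Qed.

Lemma component_lt2 n K x y : CB (J n) 3 K ->
  clos_refl_sym_trans elt (covers 2 K) x y ->
  [\/ x = y, packet_lt 2 K x y | packet_lt 2 K y x].
Proof.
move=> hK h.
have [//|[px py]] : x = y \/ (packet 2 K x /\ packet 2 K y); first last.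
- exact: packet_lt2_total hK px py.
- by constructor 1.
elim: h => {x y}.
- by move=> x y [[px py _] _]; right.
- by left.
- by move=> x y _ [->|[]]; [left | right].
- by move=> x y z _ [->|[px py]] // _ [<-|[_ pz]]; right.
Qed.

Lemma packet_lt2_ex n K : CB (J n) 3 K -> exists x y, packet_lt 2 K x y.
Proof.
by move=> /CB_tripleP[u [v [w [_ _ _ /triple_lt[h _ _]]]]]; exists (X u v), (X u w).
Qed.

Lemma X_inj_lt a b c d : a < b -> c < d -> X a b = X c d ->
  (a = c /\ b = d) \/ (a = - d /\ b = - c).
Proof. by move=> ab cd /X_inj; lia. Qed.

Lemma triple_star_abs u v w K a b : triple u v w K -> w = - u ->
  packet 2 K (X a b) -> (`|a| = `|u| \/ `|a| = `|v|) /\ (`|b| = `|u| \/ `|b| = `|v|).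
Proof.
by move=> h ew /(triple_packet _ h)[|[|[|[_]]]] /X_inj e; subst w; lia.
Qed.

Lemma triple_brk_inv u v w K a b : triple u v w K -> w <> - u -> a < b ->
  packet 2 K (X a b) ->
  (a = u /\ b = v) \/ (a = u /\ b = w) \/ (a = v /\ b = w) \/
  (a = - v /\ b = - u) \/ (a = - w /\ b = - u) \/ (a = - w /\ b = - v).
Proof.
move=> h ew ab; have [uv vw _ _ _] := h; have uw : u < w by lia.
move=> /(triple_packet _ h)[|[|[|[]//]]].
- by move=> /(X_inj_lt ab uv) [[-> ->]|[-> ->]]; tauto.
- by move=> /(X_inj_lt ab uw) [[-> ->]|[-> ->]]; tauto.
- by move=> /(X_inj_lt ab vw) [[-> ->]|[-> ->]]; tauto.
Qed.

(** [Q] will be membership in a second packet, transferred here from [x] and [y] to two named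
    crossings. *)
Lemma triple_pick u v w K x y : triple u v w K -> w <> - u -> x <> y ->
  packet 2 K x -> packet 2 K y ->
  forall Q : elt -> Prop, Q x -> Q y ->
  [\/ Q (X u v) /\ Q (X u w), Q (X u v) /\ Q (X v w) | Q (X u w) /\ Q (X v w)].
Proof.
move=> h ew nxy /(triple_packet _ h) px /(triple_packet _ h) py Q Qx Qy.
case: px => [ex|[ex|[ex|[//]]]]; case: py => [ey|[ey|[ey|[//]]]];
  try (by case: nxy; rewrite ex ey); subst x y.
all: by first [by constructor 1; split | by constructor 2; split | by constructor 3; split].
Qed.

(** Two crossings of a bracket triple involve three absolute values, those of a star packet only
    two, so the kinds cannot mix. Within one kind two elements recover the wires, the sign being
    fixed by the negative median. *)
Lemma triple_eq u v w K u' v' w' K' x y :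
  triple u v w K -> triple u' v' w' K' -> x <> y ->
  packet 2 K x -> packet 2 K y -> packet 2 K' x -> packet 2 K' y -> K = K'.
Proof.
have mixed a b c L a' b' c' L' : triple a b c L -> c <> - a ->
    triple a' b' c' L' -> c' = - a' -> x <> y ->
    packet 2 L x -> packet 2 L y -> packet 2 L' x -> packet 2 L' y -> False.
  move=> h ec h' ec' nxy px py px' py'.
  have [_ _ _ _ [[n1 n2 n3 _]|[//]]] := h.
  have A p q := @triple_star_abs _ _ _ _ p q h' ec'.
  by case: (triple_pick h ec nxy px py px' py') => -[/A ? /A ?]; lia.
move=> h h' nxy px py px' py'.
have [ew|ew] := pselect (w = - u); have [ew'|ew'] := pselect (w' = - u').
- have [_ _ _ _ [[]|[_ ->]]] := h; first by lia.
  have [_ _ _ _ [[]|[_ ->]]] := h'; first by lia.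
  have A p q := @triple_star_abs _ _ _ _ p q h' ew'.
  have [uv _ v0 _ _] := h; have [uv' _ v0' _ _] := h'.
  suff [eu ev] : u = u' /\ v = v' by rewrite eu ev.
  have [uV vV] : (`|u| = `|u'| \/ `|u| = `|v'|) /\ (`|v| = `|u'| \/ `|v| = `|v'|).
    move: px py px' py' => /(triple_packet _ h) px /(triple_packet _ h) py px' py'.
    case: px => [ex|[ex|[ex|[_ ex]]]]; case: py => [ey|[ey|[ey|[_ ey]]]];
      try (by case: nxy; rewrite ex ey); subst x y; have := A _ _ px'; have := A _ _ py';
      rewrite ?ew; lia.
  lia.
- by case: (mixed _ _ _ _ _ _ _ _ h' ew' h ew nxy).
- by case: (mixed _ _ _ _ _ _ _ _ h ew h' ew' nxy).
have [uv vw v0 _ [[_ _ _ ->]|[//]]] := h; have uw : u < w by lia.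
have [uv' vw' v0' _ [[_ _ _ ->]|[//]]] := h'.
suff [-> [-> ->]] : u = u' /\ v = v' /\ w = w' by [].
have Auv : packet 2 K' (X u v) ->
    (u = u' /\ v = v') \/ (u = u' /\ v = w') \/ (u = v' /\ v = w').
  by move=> p; have := triple_brk_inv h' ew' uv p; clear ew ew'; lia.
have Auw := triple_brk_inv h' ew' uw; have Avw := triple_brk_inv h' ew' vw.
case: (triple_pick h ew nxy px py px' py') => -[].
- by move=> /Auv[|[|]] -[e1 e2] /Auw[|[|[|[|[|]]]]] -[e3 e4]; lia.
- by move=> /Auv[|[|]] -[e1 e2] /Avw[|[|[|[|[|]]]]] -[e3 e4]; lia.
- move=> /Auw[|[|[|[|[|]]]]] -[e1 e2]; try lia.
  all: by move=> /Avw[|[|[|[|[|]]]]] -[e3 e4]; lia.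
Qed.

Lemma packet_eq2 n K K' x y : CB (J n) 3 K -> CB (J n) 3 K' ->
  packet_lt 2 K x y -> packet_lt 2 K' x y \/ packet_lt 2 K' y x -> K = K'.
Proof.
move=> hK hK' xy hxy'.
have nxy : x <> y.
  have [_ _ m] := packet_lt2_packet hK xy; have [_ I _ _] := rho_min2_total n.
  by move=> e; rewrite e in m; apply: (I y).
have [u [v [w [_ _ _ h]]]] := (CB_tripleP _ _).1 hK.
have [u' [v' [w' [_ _ _ h']]]] := (CB_tripleP _ _).1 hK'.
have [px py _] := xy.
have [px' py'] : packet 2 K' x /\ packet 2 K' y by case: hxy' => -[].
exact: triple_eq h h' nxy px py px' py'.
Qed.

(** This limits which crossings can fail to commute with a given one: apart from those sharing a
    wire, only pairs [a,*], [b,*] remain. *)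
Lemma packet_share n K x y : CB (J n) 3 K -> packet 2 K x -> packet 2 K y ->
  (exists c d e, x = X c d /\ y = X c e) \/
  (exists c d, x = X c (- c) /\ y = X d (- d)).
Proof.
move=> /CB_tripleP[u [v [w [_ _ _ h]]]] /(triple_packet _ h) hx /(triple_packet _ h) hy.
have S p q r : (exists c d e, X p q = X c d /\ X p r = X c e) by exists p, q, r.
case: hx => [->|[->|[->|[ew ->]]]]; case: hy => [->|[->|[->|[ew' ->]]]];
  try (by left; apply: S); try (by left; rewrite (XC u v); apply: S);
  try (by left; rewrite (XC u w) (XC v w); apply: S);
  try (by right; subst w; exists u, v); try (by right; subst w; exists v, u).
Qed.

(** * Triangles with latest start *)

Section Triangles.

Variables (W : int -> Prop) (P : int -> int -> nat).

Hypothesis WN : forall a, W a -> W (- a).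
Hypothesis W0 : forall a, W a -> a != 0.
Hypothesis PC : forall a b, P a b = P b a.
Hypothesis PN : forall a b, P (- a) (- b) = P a b.
Hypothesis P3 : forall a b c, W a -> W b -> W c -> a < b -> b < c ->
  ((P a b < P a c)%N /\ (P a c < P b c)%N) \/
  ((P b c < P a c)%N /\ (P a c < P a b)%N).

(** A non-inverted triangle of negative median, [P] giving the positions of the crossings. *)
Definition upright (a b c : int) : Prop :=
  [/\ W a /\ W b /\ W c, a < b, b < c, b < 0 & (P a b < P a c)%N /\ (P a c < P b c)%N].

Variables (u v w : int).

Hypothesis uvw : upright u v w.
Hypothesis uvw_max : forall a b c, upright a b c ->
  (P a b < P u v)%N \/ (P a b = P u v /\ (P v w <= P b c)%N).

(* A triangle of positive median is the mirror image of one of negative median,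
   with both orders reversed. *)
Lemma triangle_max a b c : W a -> W b -> W c -> a < b -> b < c ->
  (b < 0 -> (P a b < P a c)%N -> (P a c < P b c)%N ->
     (P a b < P u v)%N \/ (P a b = P u v /\ (P v w <= P b c)%N)) /\
  (0 < b -> (P b c < P a c)%N -> (P a c < P a b)%N ->
     (P b c < P u v)%N \/ (P b c = P u v /\ (P v w <= P a b)%N)).
Proof.
move=> Wa Wb Wc ab bc; split=> b0 h1 h2; first exact: uvw_max.
have := @uvw_max (- c) (- b) (- a).
rewrite !PN (PC c b) (PC b a); apply.
split; try lia; first by repeat split; apply: WN.
by rewrite !PN (PC c b) (PC c a) (PC b a).
Qed.

(** The wire [x] forms a triangle with each two of [u], [v], [w]. At each possible height of [x], a
    crossing inside a side would break [P3] or yield a triangle that, up to mirror image, [uvw_max]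
    excludes. *)
Lemma empty_sides x : W x -> x <> u -> x <> v -> x <> w ->
  [/\ ~ ((P u v < P u x)%N /\ (P u x < P u w)%N),
      ~ ((P u v < P v x)%N /\ (P v x < P v w)%N) &
      ~ ((P u w < P w x)%N /\ (P w x < P v w)%N)].
Proof.
have [[Wu [Wv Ww]] uv vw v0 [h1 h2]] := uvw.
move=> Wx xu xv xw; have x0 := W0 Wx; have u0 := W0 Wu; have w0 := W0 Ww.
have [xu'|[[ux xv']|[[vx xw']|wx]]] :
  x < u \/ (u < x /\ x < v) \/ (v < x /\ x < w) \/ w < x by lia.
- rewrite (PC u x) (PC v x) (PC w x).
  have := P3 Wx Wu Wv xu' uv; have := triangle_max Wx Wu Wv xu' uv.
  have xv2 : x < v by lia. have uw : u < w by lia.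
  have := P3 Wx Wv Ww xv2 vw; have := triangle_max Wx Wv Ww xv2 vw.
  have := P3 Wx Wu Ww xu' uw; have := triangle_max Wx Wu Ww xu' uw.
  split; lia.
- rewrite (PC v x) (PC w x).
  have xw2 : x < w by lia.
  have := P3 Wu Wx Wv ux xv'; have := triangle_max Wu Wx Wv ux xv'.
  have := P3 Wx Wv Ww xv' vw; have := triangle_max Wx Wv Ww xv' vw.
  have := P3 Wu Wx Ww ux xw2; have := triangle_max Wu Wx Ww ux xw2.
  split; lia.
- rewrite (PC w x).
  have ux : u < x by lia.
  have := P3 Wu Wv Wx uv vx; have := triangle_max Wu Wv Wx uv vx.
  have := P3 Wv Wx Ww vx xw'; have := triangle_max Wv Wx Ww vx xw'.
  have := P3 Wu Wx Ww ux xw'; have := triangle_max Wu Wx Ww ux xw'.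
  split; lia.
- have vx : v < x by lia. have uw : u < w by lia.
  have := P3 Wu Wv Wx uv vx; have := triangle_max Wu Wv Wx uv vx.
  have := P3 Wv Ww Wx vw wx; have := triangle_max Wv Ww Wx vw wx.
  have := P3 Wu Ww Wx uw wx; have := triangle_max Wu Ww Wx uw wx.
  split; lia.
Qed.

Lemma crossing_neq a b c : W a -> W b -> W c -> a <> b -> a <> c -> b <> c ->
  P a b <> P a c.
Proof.
move=> Wa Wb Wc ab ac bc.
have H x y z : W x -> W y -> W z -> x < y -> y < z ->
    P x y <> P x z /\ P y x <> P y z /\ P z x <> P z y.
  by move=> Wx Wy Wz xy yz; rewrite (PC y x) (PC z x) (PC z y); have := P3 Wx Wy Wz xy yz; lia.
have [h1|[h1|h1]] : a < b /\ a < c \/ b < a /\ c < a \/ b < a /\ a < c \/ c < a /\ a < b by lia.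
- have [h2|h2] : b < c \/ c < b by lia.
    by have := H a b c Wa Wb Wc; lia.
  by have := H a c b Wa Wc Wb; lia.
- have [h2|h2] : b < c \/ c < b by lia.
    by have := H b c a Wb Wc Wa; lia.
  by have := H c b a Wc Wb Wa; lia.
- case: h1 => h1.
    by have := H b a c Wb Wa Wc; lia.
  by have := H c a b Wc Wa Wb; lia.
Qed.

Hypothesis star : w = - u.

(* From here on (u, v, w) = (-b, -a, b), and P u v, P u (- u), P v (- u),
   P v (- v) are the successive elements of the packet of [a,b,*]. *)
Lemma empty_side_star x : W x -> x <> u -> x <> - u -> x <> v -> x <> - v ->
  ~ ((P v (- u) < P v x)%N /\ (P v x < P v (- v))%N).
Proof.
have [[Wu [Wv Ww]] uv vw v0 [h1 h2]] := uvw.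
move=> Wx xu xu' xv xv'; have WxN := WN Wx; have WvN := WN Wv.
have [//|E1 E2 _] := empty_sides Wx xu xv; first by rewrite star.
(* Applied to [- x], emptiness of the side on [w = - u] says that [x] does not cross [u] between
   [P u (- u)] and [P v (- u)]. *)
have [] := empty_sides WxN; try lia.
have := W0 Wx; have := W0 Wu.
rewrite star (PC (- u) (- x)) PN (PC x u) => u0 x0 _ _ E3.
rewrite star in h1 h2 E1 E2 E3.
have vv : v < - v by lia.
have eN : P u (- v) = P v (- u) by rewrite -PN opprK PC.
have D : P u x <> P u (- u) by apply: crossing_neq; rewrite -?star //; lia.
have [xu2|[[ux xv2]|[[vx xv2]|vx]]] :
  x < u \/ (u < x /\ x < v) \/ (v < x /\ x < - v) \/ - v < x by lia.
- have xv2 : x < v by lia.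
  rewrite (PC v x); have := P3 Wx Wv WvN xv2 vv; have := triangle_max Wx Wv WvN xv2 vv; lia.
- rewrite (PC v x); have := P3 Wx Wv WvN xv2 vv; have := triangle_max Wx Wv WvN xv2 vv; lia.
- have uv2 : u < - v by lia. have ux : u < x by lia.
  have := P3 Wu Wv Wx uv vx; have := P3 Wv Wx WvN vx xv2; have := P3 Wu Wx WvN ux xv2.
  rewrite eN; lia.
- have vx2 : v < x by lia. have uv2 : u < - v by lia.
  have := P3 Wv WvN Wx vv vx; have := triangle_max Wv WvN Wx vv vx.
  have := P3 Wu Wv Wx uv vx2; have := P3 Wu WvN Wx uv2 vx; rewrite eN; lia.
Qed.

(** By [empty_sides] and [empty_side_star], neither [y] nor [- y] crosses [v] strictly between
    [P u v] and [P v (- v)]; the triangles among [v], [- v], [y], [- y] then keep the crossing of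
    [y] with [- y] out of the interval. *)
Lemma empty_axis_star x : W x -> x <> u -> x <> - u -> x <> v -> x <> - v ->
  ~ ((P u (- u) < P x (- x))%N /\ (P x (- x) < P v (- v))%N).
Proof.
have [[Wu [Wv Ww]] uv vw v0 [h1 h2]] := uvw.
have pos y : W y -> 0 < y -> y <> - u -> y <> - v ->
    ~ ((P u (- u) < P y (- y))%N /\ (P y (- y) < P v (- v))%N).
  move=> Wy y0 yu yv; have WyN := WN Wy; have WvN := WN Wv.
  have [|||_ E2 _] := empty_sides Wy; try lia.
  have [|||_ E2' _] := empty_sides WyN; try lia.
  have S : ~ ((P v (- u) < P v y)%N /\ (P v y < P v (- v))%N).
    by apply: empty_side_star => //; lia.
  have S' : ~ ((P v (- u) < P v (- y))%N /\ (P v (- y) < P v (- v))%N).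
    by apply: empty_side_star => //; lia.
  have D : P v y <> P v (- u) by apply: crossing_neq; rewrite -?star //; lia.
  have D' : P v (- y) <> P v (- u) by apply: crossing_neq; rewrite -?star //; lia.
  rewrite star in h1 h2 E2 E2'.
  have eN : P (- y) (- v) = P v y by rewrite PN PC.
  have eN' : P (- v) y = P v (- y) by rewrite -PN opprK.
  rewrite (PC y (- y)).
  have [yv'|vy] : y < - v \/ - v < y by lia.
    have := @P3 (- y) y (- v) WyN Wy WvN; have := @P3 v (- y) (- v) Wv WyN WvN.
    have := @P3 v y (- v) Wv Wy WvN.
    rewrite eN (PC y (- v)) eN'; lia.
  have := @P3 (- y) (- v) y WyN WvN Wy; have := @P3 v (- v) y Wv WvN Wy.
  have := @P3 (- y) v (- v) WyN Wv WvN.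
  rewrite eN eN' (PC (- y) v); lia.
have [x_gt0|x_le0] := ltP 0 x; first by move=> *; apply: pos => //; lia.
move=> Wx xu xu' xv xv'; have := pos (- x); rewrite opprK (PC (- x) x); apply; try lia.
  exact: WN.
by have := W0 Wx; lia.
Qed.

End Triangles.

(** * Choice of an extremal triangle and gathering of its packet *)

Lemma bounded_argmax (T : Type) (Q : T -> Prop) (m : T -> nat) (B : nat) :
  (exists x, Q x) -> (forall x, Q x -> (m x <= B)%N) ->
  exists2 x, Q x & forall y, Q y -> (m y <= m x)%N.
Proof.
move=> [x Qx] hB; have [d] := ubnP (B - m x); elim: d x Qx => // d IH x Qx hd.
have [h|h] := pselect (forall y, Q y -> (m y <= m x)%N); first by exists x.
have [y [Qy yx]] : exists y, Q y /\ (m x < m y)%N.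
  apply: contrapT => n; apply: h => y Qy; rewrite leqNgt; apply/negP => h.
  by apply: n; exists y.
by apply: (IH y Qy); have := hB _ Qy; lia.
Qed.

Lemma X_mem n u e : u \in J n -> CB (J n) 2 (X u e) -> e \in J n /\ e <> u.
Proof.
move=> uJ /CB_J_pairP[c [d [cJ dJ cd /X_inj]]].
by case=> [|[|[|]]] -[-> ->]; rewrite ?JN; split=> //; lia.
Qed.

(** A crossing on [- u] is also one on [u], so the shared wire can be taken to be [u] or [v]
    itself. *)
Lemma share_wire u v x y : u != 0 -> v != 0 -> x = X u v ->
  (exists c d e, x = X c d /\ y = X c e) \/
  (exists c d, x = X c (- c) /\ y = X d (- d)) ->
  [\/ exists e, y = X u e, exists e, y = X v e |
      v = - u /\ exists d, y = X d (- d)].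
Proof.
move=> u0 v0 ->; case=> [[c [d [e [/X_inj h ->]]]]|[c [d [/X_inj h ->]]]]; last first.
  by constructor 3; split; [lia | exists d].
case: h => [|[|[|]]] -[eu ev].
- by constructor 1; exists e; rewrite eu.
- by constructor 2; exists e; rewrite ev.
- by constructor 1; exists (- e); rewrite XNr eu opprK.
- by constructor 2; exists (- e); rewrite XNr ev opprK.
Qed.

Lemma ncommute_share n x y : ~ commute n 2 x y ->
  (exists c d e, x = X c d /\ y = X c e) \/
  (exists c d, x = X c (- c) /\ y = X d (- d)).
Proof.
move=> nc; apply: contrapT => ns; apply: nc => K hK px py.
by case: ns; apply: packet_share hK px py.
Qed.

(** The packet order is total for [k = 2], so the whole packet is a single component. *)
Lemma N_of_gaps n K sigma : CB (J n) 3 K ->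
  (forall x y z, packet 2 K x -> packet 2 K z -> sigma x y -> sigma y z ->
     packet 2 K y) -> N n 2 sigma K.
Proof.
move=> hK gap; split=> // D hD x y z Dx Dz xy yz.
have [w pw eD] := hD; move: Dx Dz; rewrite eD /= => -[px wx] [pz _].
have py := gap _ _ _ px pz xy yz; split=> //; apply: rst_trans wx _.
have S a b : packet_lt 2 K a b -> clos_refl_sym_trans elt (covers 2 K) a b.
  move=> h; have /sameE[//] := packet_lt_same (enumerable_CB2 n)
    (@packet_lt2_packet n) (rho_min2_total n) hK h.
have [->|/S//|/S h] := packet_lt2_total hK px py; first exact: rst_refl.
exact: rst_sym.
Qed.

(* The packet of [K] is gathered around its element [c], by ordering
   lexicographically with all of the packet first moved to the place of [c]. *)
Lemma gather n K c f : CB (J n) 3 K -> inj_on (CB (J n) 2) f ->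
  packet 2 K c -> CB (J n) 2 c ->
  (forall x y, packet 2 K x -> CB (J n) 2 y -> ~ packet 2 K y ->
     ~ commute n 2 x y -> (f x < f y)%N <-> (f c < f y)%N) ->
  exists sigma, [/\ total_order_on (CB (J n) 2) sigma,
    agree n 2 (key_order (CB (J n) 2) f) sigma & N n 2 sigma K].
Proof.
move=> hK fI cK Cc H; have [L hL] := enumerable_CB2 n.
set C := CB (J n) 2 in fI Cc H hL *.
pose M := (\max_(x <- L) f x).+1.
have fM x : C x -> (f x < M)%N.
  by move=> /hL xL; rewrite ltnS; apply: (@leq_bigmax_seq _ _ xpredT f).
pose p x := if `[< packet 2 K x >] then f c else f x.
have pK x : packet 2 K x -> p x = f c by move=> h; rewrite /p asboolT.
have pN x : ~ packet 2 K x -> p x = f x by move=> h; rewrite /p asboolF.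
have fc x : C x -> ~ packet 2 K x -> f x <> f c.
  by move=> Cx h e; apply: h; rewrite (fI _ _ Cx Cc e).
(* [M] exceeds every key, so [g] compares [p] first and breaks ties, which occur only inside the
   packet, by [f]. *)
pose g x := (p x * M + f x)%N.
have gp x y : C x -> C y -> (p x < p y)%N -> (g x < g y)%N.
  move=> /fM hx _ h; rewrite /g; have : ((p x).+1 * M <= p y * M)%N by rewrite leq_mul2r h orbT.
  by rewrite mulSn; lia.
have pg x y : C x -> C y -> (g x < g y)%N -> (p x <= p y)%N.
  move=> Cx Cy gxy; rewrite leqNgt; apply/negP => h.
  by have := gp _ _ Cy Cx h; lia.
exists (key_order C g); split.
- apply: key_order_total => x y Cx Cy e; apply: fI => //.
  have [h|[h|h]] : (p x < p y)%N \/ (p y < p x)%N \/ p x = p y by lia.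
  + by have := gp _ _ Cx Cy h; lia.
  + by have := gp _ _ Cy Cx h; lia.
  + by move: e; rewrite /g h; lia.
- move=> x y [Cx Cy fxy] nc; split=> //.
  have [Kx|nKx] := pselect (packet 2 K x); have [Ky|nKy] := pselect (packet 2 K y).
  + by rewrite /g (pK x) // (pK y) //; lia.
  + by apply: gp => //; rewrite (pK x) // (pN y) //; apply/(H x y).
  + apply: gp => //; rewrite (pN x) // (pK y) //.
    have nc' : ~ commute n 2 y x by move=> /commuteC.
    by have := H y x Ky Cx nKx nc'; have := fc _ Cx nKx; lia.
  + by apply: gp => //; rewrite (pN x) // (pN y).
- apply: N_of_gaps => // x y z Kx Kz [Cx Cy xy] [_ Cz yz].
  apply: contrapT => nKy; have := pg _ _ Cx Cy xy; have := pg _ _ Cy Cz yz.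
  by rewrite (pK x) // (pK z) // (pN y) //; have := fc _ Cy nKy; lia.
Qed.

(** Keys of [rho] serve as positions [P] of crossings. The sides of an extremal upright triangle
    being empty, no outside crossing that fails to commute with a packet element separates it from
    [X u w], and [gather] applies around [X u w]. *)
Lemma up_step2 n rho : AB n 2 rho ->
  (exists2 K, CB (J n) 3 K & ~ Inv n 2 rho K) ->
  exists sigma K, [/\ total_order_on (CB (J n) 2) sigma, agree n 2 rho sigma,
                      N n 2 sigma K & ~ Inv n 2 rho K].
Proof.
move=> [tr adm] [K0 hK0 nI0].
have [L hL] := enumerable_CB2 n.
have [f fI erho] := total_orderE (enumerable_CB2 n) tr; subst rho.
set C := CB (J n) 2 in tr fI adm hL nI0 *.
pose P u v := f (X u v).
have CX u v : u \in J n -> v \in J n -> u <> v -> C (X u v).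
  move=> uJ vJ uv; apply/CB_J_pairP.
  have [h|h] : u < v \/ v < u by lia.
    by exists u, v.
  by exists v, u; rewrite XC.
have PC a b : P a b = P b a by rewrite /P XC.
have PN a b : P (- a) (- b) = P a b by rewrite /P XN.
pose W u := is_true (u \in J n).
have WN a : W a -> W (- a) by rewrite /W JN.
have W0 a : W a -> a != 0 by apply: J_neq0.
have P3n a b c : W a -> W b -> W c -> a < b -> b < c -> b < 0 ->
  ((P a b < P a c)%N /\ (P a c < P b c)%N) \/ ((P b c < P a c)%N /\ (P a c < P a b)%N).
  move=> Wa Wb Wc ab bc b0; have c0 := W0 _ Wc.
  (* The relevant packet depends on whether [c] is [- b], [- a] or neither. If [c = - b], the three
     crossings are the first, third and fourth elements of a star packet. *)
  have [K hK [h1 h2]] : exists2 K, CB (J n) 3 K &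
      packet_lt 2 K (X a b) (X a c) /\ packet_lt 2 K (X a c) (X b c).
    have [s1 s2] := std_triple ab bc b0 c0.
    have [e|ne] := pselect (c = - b).
      have h : triple a b (- a) (Star [fset - a; - b]%fset).
        by split; try lia; right.
      exists (Star [fset - a; - b]%fset).
        by apply/CB_tripleP; exists a, b, (- a); rewrite JN.
      have [[p1 _ _] [_ q2 _] h3] := triple_lt h.
      have eX : X a c = X b (- a) by rewrite e XNr XC.
      rewrite eX in s1 *; split; first by split.
      by rewrite e; apply: h3.
    have [e|ne'] := pselect (c = - a).
      have h : triple a b c (Star [fset - a; - b]%fset) by split=> //; right.
      exists (Star [fset - a; - b]%fset); first by apply/CB_tripleP; exists a, b, c.
      by have [h1 h2 _] := triple_lt h.
    have h : triple a b c (brk [fset a; b; c]%fset).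
      by split=> //; left; split=> // ?; lia.
    exists (brk [fset a; b; c]%fset); first by apply/CB_tripleP; exists a, b, c.
    by have [h1' h2' _] := triple_lt h.
  by case: (adm K hK) => e; [left|right]; have [_ _ l1] := e _ _ h1;
    have [_ _ l2] := e _ _ h2.
have P3 a b c : W a -> W b -> W c -> a < b -> b < c ->
  ((P a b < P a c)%N /\ (P a c < P b c)%N) \/ ((P b c < P a c)%N /\ (P a c < P a b)%N).
  move=> Wa Wb Wc ab bc; have [b0|b0] : b < 0 \/ 0 < b by have := W0 _ Wb; lia.
    exact: P3n.
  have := @P3n (- c) (- b) (- a) (WN _ Wc) (WN _ Wb) (WN _ Wa).
  rewrite !PN (PC c b) (PC c a) (PC b a) => H.
  have [||||] := H; try lia; tauto.
pose up (t : int * int * int) := upright W P t.1.1 t.1.2 t.2.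
pose B := \max_(x <- L) f x.
have PB a b : W a -> W b -> a <> b -> (P a b <= B)%N.
  move=> Wa Wb ab; apply: (@leq_bigmax_seq _ _ xpredT f) => //.
  exact/hL/CX.
(* The weight encodes a lexicographic choice, latest first crossing and then earliest last crossing;
   as [B] bounds all positions, the second term stays below the multiplier [B.+1]. *)
have [[[u v] w] uvw tmax] : exists2 t, up t & forall t', up t' ->
  (P t'.1.1 t'.1.2 * B.+1 + (B - P t'.1.2 t'.2) <=
   P t.1.1 t.1.2 * B.+1 + (B - P t.1.2 t.2))%N.
  apply: (@bounded_argmax _ up (fun t => P t.1.1 t.1.2 * B.+1 + (B - P t.1.2 t.2))%N
    (B * B.+1 + B)).
    have [u [v [w [uJ vJ wJ h]]]] := (CB_tripleP _ _).1 hK0.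
    have [uv vw v0 w0 _] := h; have [h1 h2 _] := triple_lt h.
    exists (u, v, w); split=> //.
    have e : extends (key_order C f) (packet_lt 2 K0).
      by case: (adm K0 hK0) => // e; case: nI0.
    by have [_ _ l1] := e _ _ h1; have [_ _ l2] := e _ _ h2.
  move=> [[a b] c] [[Wa [Wb Wc]] /= ab bc b0 _].
  have h1 : (P a b <= B)%N by apply: PB => //; lia.
  by apply: leq_add; [rewrite leq_mul2r h1 orbT | apply: leq_subr].
rewrite /up /= in uvw tmax.
have umax a b c : upright W P a b c ->
    (P a b < P u v)%N \/ (P a b = P u v /\ (P v w <= P b c)%N).
  move=> h; have := tmax (a, b, c) h; rewrite /=.
  have [[Wa [Wb Wc]] ab bc _ _] := h; have [[Wu [Wv Ww]] uv vw _ _] := uvw.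
  have h1 : (P b c <= B)%N by apply: PB => //; lia.
  have h2 : (P v w <= B)%N by apply: PB => //; lia.
  move: (P a b) (P u v) (P b c) (P v w) h1 h2 => p q r s h1 h2 H.
  have [pq|[pq|qp]] : (p < q)%N \/ p = q \/ (q < p)%N by lia.
  - by left.
  - by right; split=> //; move: H; rewrite pq; lia.
  - have : (q.+1 * B.+1 <= p * B.+1)%N by rewrite leq_mul2r qp orbT.
    by rewrite mulSn; lia.
have [[Wu [Wv Ww]] uv vw v0 [h1 h2]] := uvw.
have u0 := W0 _ Wu; have v0' := W0 _ Wv; have w0 := W0 _ Ww.
have CuV : C (X u v) by apply: CX => //; lia.
have CuW : C (X u w) by apply: CX => //; lia.
have CvW : C (X v w) by apply: CX => //; lia.
have nInv K : triple u v w K -> ~ Inv n 2 (key_order C f) K.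
  move=> h [_ e]; have [l _ _] := triple_lt h.
  by have [_ _] := e (X u w) (X u v) l; rewrite -/(P u w) -/(P u v); lia.
(* If [w = - v], the triangle [u], [v], [- u] would also start at [P u v] but end at [P u w], before
   [P v w]. *)
have nwv : w <> - v.
  move=> ew; have WuN := WN _ Wu; have vu : v < - u by lia.
  have eP : P v (- u) = P u w by rewrite ew -PN opprK PC.
  have := P3 u v (- u) Wu Wv WuN uv vu => H3.
  have : upright W P u v (- u) by split=> //; lia.
  by move=> /umax; rewrite eP; lia.
have ES := empty_sides WN W0 PC PN P3 uvw umax.
(* Away from [w = - u] the three absolute values are distinct, and the packet consists of the three
   crossings of the triangle. *)
have [ew|ew] := pselect (w = - u); last first.
  have h : triple u v w (brk [fset u; v; w]%fset).
    by split=> //; left; split=> // ?; lia.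
  set K := brk _ in h.
  have hK : CB (J n) 3 K by apply/CB_tripleP; exists u, v, w.
  have PK := triple_packet _ h.
  have cK : packet 2 K (X u w) by apply/PK; tauto.
  have [|sigma [ts ag hN]] := gather hK fI cK CuW; last first.
    by exists sigma, K; split=> //; apply: nInv.
  move=> x y Kx Cy nKy /ncommute_share sh.
  have ny e : y = X u e -> [/\ W e, e <> u, e <> v & e <> w].
    move=> ey; rewrite ey in Cy; have [We eu] := X_mem Wu Cy.
    by split=> // ee; apply: nKy; apply/PK; rewrite ey ee; tauto.
  have ny' e : y = X v e -> [/\ W e, e <> u, e <> v & e <> w].
    move=> ey; rewrite ey in Cy; have [We ev] := X_mem Wv Cy.
    by split=> // ee; apply: nKy; apply/PK; rewrite ey ee; [left; rewrite XC | tauto].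
  have ny'' e : y = X w e -> [/\ W e, e <> u, e <> v & e <> w].
    move=> ey; rewrite ey in Cy; have [We ew'] := X_mem Ww Cy.
    by split=> // ee; apply: nKy; apply/PK; rewrite ey ee XC; tauto.
  have neq z : packet 2 K z -> C z -> f y <> f z.
    by move=> Kz Cz e; apply: nKy; rewrite (fI _ _ Cy Cz e).
  have nc := neq _ cK CuW; rewrite -/(P u w) in nc *.
  move: Kx => /PK[ex|[ex|[ex|[//]]]]; rewrite ex -?/(P u v) -?/(P u w) -?/(P v w).
  - have [[e ey]|[e ey]|[]] := share_wire u0 v0' ex sh; last by lia.
      have [We e1 e2 e3] := ny _ ey; have [E _ _] := ES e We e1 e2 e3.
      by move: nc; rewrite ey -/(P u e); lia.
    have [We e1 e2 e3] := ny' _ ey; have [_ E _] := ES e We e1 e2 e3.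
    by move: nc; rewrite ey -/(P v e); lia.
  - by [].
  - have nvw : f y <> P v w by apply: neq => //; apply/PK; tauto.
    have [[e ey]|[e ey]|[]] := share_wire v0' w0 ex sh; last by lia.
      have [We e1 e2 e3] := ny' _ ey; have [_ E _] := ES e We e1 e2 e3.
      by move: nc nvw; rewrite ey -/(P v e); lia.
    have [We e1 e2 e3] := ny'' _ ey; have [_ _ E] := ES e We e1 e2 e3.
    by move: nc nvw; rewrite ey -/(P w e); lia.
(* With [w = - u] the packet has a further last element [X v (- v)], so the stretch leading to it
   must be empty as well. *)
have h : triple u v w (Star [fset - u; - v]%fset) by split=> //; right.
set K := Star _ in h.
have hK : CB (J n) 3 K by apply/CB_tripleP; exists u, v, w.
have PK := triple_packet _ h.
have cK : packet 2 K (X u w) by apply/PK; tauto.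
have [|sigma [ts ag hN]] := gather hK fI cK CuW; last first.
  by exists sigma, K; split=> //; apply: nInv.
move=> x y Kx Cy nKy /ncommute_share sh.
have ny e : y = X u e -> [/\ W e, e <> u, e <> - u, e <> v & e <> - v].
  move=> ey; rewrite ey in Cy; have [We eu] := X_mem Wu Cy.
  split=> // ee; apply: nKy; apply/PK; rewrite ey ee; [right; left; rewrite ew | left |] => //.
  by right; right; left; rewrite ew XNr XC.
have ny' e : y = X v e -> [/\ W e, e <> u, e <> - u, e <> v & e <> - v].
  move=> ey; rewrite ey in Cy; have [We ev] := X_mem Wv Cy.
  split=> // ee; apply: nKy; apply/PK; rewrite ey ee; [left; rewrite XC | | ] => //.
    by right; right; left; rewrite ew.
  by right; right; right.
have ny'' e : y = X e (- e) -> [/\ W e, e <> u, e <> - u, e <> v & e <> - v].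
  move=> ey; have We : W e.
    move: (Cy); rewrite ey => /CB_J_pairP[c [d [cJ dJ cd /X_inj]]].
    by case=> [|[|[|]]] -[-> _]; rewrite /W ?JN.
  by split=> // ee; apply: nKy; apply/PK; rewrite ey ee ?opprK ew;
    rewrite 1?(XC (- u)) 1?(XC (- v)); tauto.
have neq z : packet 2 K z -> C z -> f y <> f z.
  by move=> Kz Cz e; apply: nKy; rewrite (fI _ _ Cy Cz e).
have nc := neq _ cK CuW; rewrite -/(P u w) in nc *.
have ESS := empty_side_star WN W0 PC PN P3 uvw umax ew.
have EAS := empty_axis_star WN W0 PC PN P3 uvw umax ew.
have nvw : f y <> P v w by apply: neq => //; apply/PK; tauto.
(* The empty side on [w = - u] is carried over to wire [u] by replacing [e] with [- e]. *)
have E1 e : W e -> e <> u -> e <> - u -> e <> v -> e <> - v ->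
  [/\ ~ (P u v < P u e < P u w)%N, ~ (P u v < P v e < P v w)%N &
     ~ (P u w < P u e < P v w)%N].
  move=> We e1 e2 e3 e4; have [|E E' _] := ES e We e1 e3; first by rewrite ew.
  have [|||_ _ E''] := ES (- e) (WN _ We); try lia.
  have eW : P w (- e) = P u e by rewrite [in LHS]ew PN.
  by rewrite eW in E''; split; lia.
move: Kx => /PK[ex|[ex|[ex|[_ ex]]]]; rewrite ex -?/(P u v) -?/(P u w) -?/(P v w).
- have [[e ey]|[e ey]|[]] := share_wire u0 v0' ex sh; last by lia.
    have [We e1 e2 e3 e4] := ny _ ey; have [E _ _] := E1 e We e1 e2 e3 e4.
    by move: nc; rewrite ey -/(P u e); lia.
  have [We e1 e2 e3 e4] := ny' _ ey; have [_ E _] := E1 e We e1 e2 e3 e4.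
  by move: nc; rewrite ey -/(P v e); lia.
- by [].
- have [[e ey]|[e ey]|[]] := share_wire v0' w0 ex sh; last by lia.
    have [We e1 e2 e3 e4] := ny' _ ey; have [_ E _] := E1 e We e1 e2 e3 e4.
    by move: nc nvw; rewrite ey -/(P v e); lia.
  rewrite ew -XNr in ey.
  have [We e1 e2 e3 e4] := ny _ ey; have [_ _ E] := E1 _ We e1 e2 e3 e4.
  by move: nc nvw; rewrite ey -/(P u (- e)); lia.
have CvV : C (X v (- v)) by apply: CX => //; [exact: WN | lia].
have nvv : f y <> P v (- v) by apply: neq => //; apply/PK; tauto.
rewrite -/(P v (- v)).
(* On wire [v], the stretch up to [P v w] is a side of the triangle, and [ESS] covers the rest up to
   [P v (- v)]. *)
have onv e : y = X v e -> (P v (- v) < f y)%N <-> (P u w < f y)%N.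
  move=> ey; have [We e1 e2 e3 e4] := ny' _ ey; have [_ E _] := E1 e We e1 e2 e3 e4.
  have := ESS e We e1 e2 e3 e4; rewrite -ew => E'.
  have := P3 u v (- v) Wu Wv (WN _ Wv) uv.
  have eP : P u (- v) = P v w by rewrite ew -PN opprK PC.
  by rewrite eP; move: nc nvw nvv; rewrite ey -/(P v e); lia.
have vN0 : - v != 0 by lia.
have [[e ey]|[e ey]|[_ [e ey]]] := share_wire v0' vN0 ex sh.
- exact: onv ey.
- by apply: (onv (- e)); rewrite XNr.
(* The remaining crossings that may fail to commute with [X v (- v)] are of the form [d,*], handled
   by [EAS]. *)
have [We e1 e2 e3 e4] := ny'' _ ey; have := EAS e We e1 e2 e3 e4; rewrite -ew => E.
have := P3 u v (- v) Wu Wv (WN _ Wv) uv.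
have eP : P u (- v) = P v w by rewrite ew -PN opprK PC.
by rewrite eP; move: nc nvw nvv; rewrite ey -/(P e (- e)); lia.
Qed.

Theorem theorem9 (n k : nat) (hn : (1 <= n)%N) (hk : k = 1%N \/ k = 2%N) :
  (forall r : set eorder, maximal n k r <-> r = cls n k (rho_max n k)) /\
  (forall r : set eorder, minimal n k r <-> r = cls n k (rho_min n k)).
Proof.
case: hk => ->.
  exact: (extremal_classes (enumerable_CB1 n) (@packet_lt1_packet n)
    (rho_min1_total n) (@packet_lt1_ex n) (@component_lt1 n) (@packet_eq1 n)
    (@up_step1 n)).
exact: (extremal_classes (enumerable_CB2 n) (@packet_lt2_packet n)
  (rho_min2_total n) (@packet_lt2_ex n) (@component_lt2 n) (@packet_eq2 n)
  (@up_step2 n)).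
Qed.
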